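(* Let $\varphi$ be a holomorphic self-map of $\mathbb{D}$ and $C_\varphi:H^2(\mathbb{D})\to H^2(\mathbb{D})$ the corresponding composition operator. Then the adjoint $C_\varphi^*$ is a composition operator (i.e. $C_\varphi^*=C_\psi$ for some holomorphic self-map $\psi$ of $\mathbb{D}$) if and only if $\varphi(z)=\delta z$ for some constant $\delta\in\mathbb{C}$ with $|\delta|\le1$.
   Context: $\mathbb{D}$ is the open unit disc; $H^2(\mathbb{D})$ is the Hardy space of holomorphic $f(z)=\sum a_nz^n$ with $\|f\|^2=\sum|a_n|^2<\infty$, a reproducing kernel Hilbert space with kernel $\kappa_w(z)=\frac{1}{1-\overline{w}z}$. $C_\varphi f=f\circ\varphi$. *)

(* Defs.v *)
From Stdlib Require Import Reals.
From Coquelicot Require Import Coquelicot.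
Open Scope R_scope.

Definition in_disc (z : C) : Prop := Cmod z < 1.

Definition holo_self_map (phi : C -> C) : Prop :=
  (forall z, in_disc z -> @ex_derive C_AbsRing C_NormedModule phi z) /\
  (forall z, in_disc z -> in_disc (phi z)).

(* H^2(D) is identified with the space of Taylor coefficient sequences
   a with sum |a_n|^2 < oo; the function is f(z) = sum a_n z^n. *)
Definition in_H2 (a : nat -> C) : Prop :=
  ex_series (fun n => Cmod (a n) ^ 2).

Definition h2_eval_is (a : nat -> C) (z w : C) : Prop :=
  @is_series C_AbsRing C_NormedModule (fun n => (a n * Cpow z n)%C) w.

(* c is (the coefficient sequence of) C_phi a, i.e. c in H^2 and
   f_c = f_a o phi on D. *)
Definition comp_op_is (phi : C -> C) (a c : nat -> C) : Prop :=
  in_H2 c /\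
  forall z, in_disc z -> exists w, h2_eval_is a (phi z) w /\ h2_eval_is c z w.

Definition h2_inner_is (a b : nat -> C) (l : C) : Prop :=
  @is_series C_AbsRing C_NormedModule (fun n => (a n * Cconj (b n))%C) l.

Definition adjoint_is_comp (phi psi : C -> C) : Prop :=
  forall a b c d : nat -> C,
    in_H2 a -> in_H2 b -> comp_op_is phi a c -> comp_op_is psi b d ->
    exists l, h2_inner_is c b l /\ h2_inner_is a d l.

(* Main.v *)
Require Import Defs.
From Stdlib Require Import Reals Lra Lia Classical ClassicalEpsilon ZArith.
From Coquelicot Require Import Coquelicot.
Open Scope R_scope.

(** If [C_phi^* = C_psi], testing the adjoint relation on monomials gives
    [[z^n] phi^m = conj ([z^m] psi^n)].  The pair [m = 0, n = 1] yields [psi 0 = 0]; with [m = 1]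
    the right-hand side then vanishes for [n = 0] and, since [psi^n = O(z^2)], for [n >= 2].
    Hence [phi z = c z].  Conversely [phi z = delta z] multiplies the n-th coefficient by
    [delta^n], a diagonal operator whose adjoint belongs to [psi z = conj delta * z].

    Both [phi] and [psi^n] must first be known to have square-summable Taylor coefficients.
    Goursat's bisection argument in the coordinate [w = log z] shows that the Fourier
    coefficients of [f] on the circle of radius [r] are [a_k r^k], with [a_k = 0] for [k < 0] when
    [f] is bounded, and Bessel's inequality gives [sum |a_k|^2 < oo].  The expansion at [z0]
    follows from Fourier coefficients of [g] in [f z - f z0 = (z - z0) g] on the circle through
    [z0]: the partial sums telescope to terms that tend to 0 by Bessel's inequality. *)

(** * Goursat's lemma for closed forms *)

(** [adjoint_is_comp] is a relation between sequences: it speaks only of those [a], [b] for which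
    images [c], [d] are given, so it says nothing about monomials until coefficient sequences of the
    composites have been produced. Producing them is the bulk of the work, because [holo_self_map]
    provides a complex derivative at each point and no continuity of that derivative; hence
    Goursat's argument and not Green's formula. The logarithm reduces contour integrals to real
    integrals over the sides of a rectangle: concentric circles become its vertical sides, and f(z)
    z^(-k-1) dz becomes f(e^w) e^(-k w) dw, whose period 2 pi i makes the horizontal sides cancel.
    In the converse, [c] and [d] are arbitrary sequences that represent the composites, so the
    diagonal form of the operator has to be derived from the uniqueness of power series
    coefficients. *)

Lemma nested_intervals (a b : nat -> R) :
  (forall n, a n <= a (S n)) -> (forall n, b (S n) <= b n) ->
  (forall n, a n <= b n) -> exists x, forall n, a n <= x <= b n.
Proof.
  intros Ha Hb Hab.
  assert (Ha' : forall n m, (n <= m)%nat -> a n <= a m).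
  { intros n m H; induction H; [lra|]. specialize (Ha m); lra. }
  assert (Hb' : forall n m, (n <= m)%nat -> b m <= b n).
  { intros n m H; induction H; [lra|]. specialize (Hb m); lra. }
  assert (Hle : forall n m, a n <= b m).
  { intros n m.
    pose proof (Ha' n (Nat.max n m) ltac:(lia)).
    pose proof (Hb' m (Nat.max n m) ltac:(lia)).
    specialize (Hab (Nat.max n m)); lra. }
  destruct (completeness (fun x => exists n, x = a n)) as [x [Hub Hlub]].
  - exists (b O); intros y [n ->]; apply Hle.
  - exists (a O), O; reflexivity.
  - exists x; intros n; split.
    + apply Hub; exists n; reflexivity.
    + apply Hlub; intros y [m ->]; apply Hle.
Qed.

Lemma pow2_inv_small (w del : R) :
  0 < del -> exists n, w / 2 ^ n < del.
Proof.
  intros Hdel.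
  destruct (Rle_lt_dec w 0) as [Hw|Hw].
  { exists O; simpl; lra. }
  destruct (Pow_x_infinity 2 ltac:(rewrite Rabs_right; lra) (2 * w / del)) as [n Hn].
  exists n. specialize (Hn n (le_n n)).
  assert (H2 : 0 < 2 ^ n) by (apply pow_lt; lra).
  rewrite Rabs_right in Hn by lra.
  apply (Rmult_lt_reg_r (2 ^ n)); [exact H2|].
  unfold Rdiv; rewrite Rmult_assoc, Rinv_l, Rmult_1_r by lra.
  apply Rge_le in Hn.
  apply (Rmult_le_compat_l del) in Hn; [|lra].
  replace (del * (2 * w / del)) with (2 * w) in Hn by (field; lra).
  lra.
Qed.

(** Repeatedly choosing a quarter that satisfies [S] gives nested rectangles with a common point.
    Both sides are divided by the same [2 ^ n]: every rectangle is similar to the first one, so its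
    area and its squared diameter stay in a fixed ratio. *)
Lemma rectangle_bisection (S : R -> R -> R -> R -> Prop) (a b c d : R) :
  a <= b -> c <= d ->
  (forall a' b' c' d', a <= a' -> a' <= b' -> b' <= b -> c <= c' -> c' <= d' -> d' <= d ->
     S a' b' c' d' ->
     let m := (a' + b') / 2 in let k := (c' + d') / 2 in
     S a' m c' k \/ S m b' c' k \/ S a' m k d' \/ S m b' k d') ->
  S a b c d ->
  exists x y, forall del, 0 < del -> exists n a' b' c' d',
    (a <= a' <= x /\ x <= b' <= b) /\ (c <= c' <= y /\ y <= d' <= d) /\
    (b' - a' = (b - a) / 2 ^ n /\ b' - a' < del) /\
    (d' - c' = (d - c) / 2 ^ n /\ d' - c' < del) /\
    S a' b' c' d'.
Proof.
  intros Hab Hcd Hstep HS.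
  set (inv := fun q : (R * R) * (R * R) =>
    let '((a', b'), (c', d')) := q in
    a <= a' /\ a' <= b' /\ b' <= b /\ c <= c' /\ c' <= d' /\ d' <= d /\ S a' b' c' d').
  set (half := fun u v : R * R =>
    fst u <= fst v /\ snd v <= snd u /\ snd v - fst v = (snd u - fst u) / 2).
  (* The premise [inv q] sits under the existential, so that choice yields a total successor
     function that can be iterated. *)
  assert (Hnext : forall q, exists q', inv q ->
    inv q' /\ half (fst q) (fst q') /\ half (snd q) (snd q')).
  { intros [[a' b'] [c' d']].
    destruct (classic (inv ((a', b'), (c', d')))) as [Hi|Hi].
    2: exists ((a', b'), (c', d')); contradiction.
    destruct Hi as (h1 & h2 & h3 & h4 & h5 & h6 & h7).
    destruct (Hstep a' b' c' d' h1 h2 h3 h4 h5 h6 h7) as [H|[H|[H|H]]];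
    [ exists ((a', (a' + b') / 2), (c', (c' + d') / 2))
    | exists (((a' + b') / 2, b'), (c', (c' + d') / 2))
    | exists ((a', (a' + b') / 2), ((c' + d') / 2, d'))
    | exists (((a' + b') / 2, b'), ((c' + d') / 2, d')) ];
    intros _; unfold inv, half; simpl; repeat split; try exact H; lra. }
  set (nxt := fun q => proj1_sig (constructive_indefinite_description _ (Hnext q))).
  assert (Hnxt := fun q => proj2_sig (constructive_indefinite_description _ (Hnext q))).
  set (q := fix q n := match n with O => ((a, b), (c, d)) | Datatypes.S n => nxt (q n) end).
  assert (Hinv : forall n, inv (q n)).
  { induction n as [|n IH]; [|exact (proj1 (Hnxt _ IH))].
    simpl; repeat split; try lra; exact HS. }
  assert (Hhalf : forall n, half (fst (q n)) (fst (q (Datatypes.S n))) /\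
                            half (snd (q n)) (snd (q (Datatypes.S n)))).
  { intros n; exact (proj2 (Hnxt _ (Hinv n))). }
  assert (Hsize : forall n, snd (fst (q n)) - fst (fst (q n)) = (b - a) / 2 ^ n /\
                            snd (snd (q n)) - fst (snd (q n)) = (d - c) / 2 ^ n).
  { induction n as [|n [IH1 IH2]]; [simpl; split; lra|].
    destruct (Hhalf n) as [(_ & _ & h1) (_ & _ & h2)].
    rewrite h1, h2, IH1, IH2. simpl pow.
    assert (2 ^ n <> 0) by (apply pow_nonzero; lra).
    split; field; assumption. }
  destruct (nested_intervals (fun n => fst (fst (q n))) (fun n => snd (fst (q n)))) as [x Hx].
  { intros n; apply (Hhalf n). }
  { intros n; apply (Hhalf n). }
  { intros n; generalize (Hinv n); destruct (q n) as [[? ?] [? ?]]; simpl; tauto. }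
  destruct (nested_intervals (fun n => fst (snd (q n))) (fun n => snd (snd (q n)))) as [y Hy].
  { intros n; apply (Hhalf n). }
  { intros n; apply (Hhalf n). }
  { intros n; generalize (Hinv n); destruct (q n) as [[? ?] [? ?]]; simpl; tauto. }
  exists x, y. intros del Hdel.
  destruct (pow2_inv_small (Rmax (b - a) (d - c)) del Hdel) as [n Hn].
  assert (Hp : 0 < / 2 ^ n) by (apply Rinv_0_lt_compat, pow_lt; lra).
  assert (H1 : (b - a) / 2 ^ n < del).
  { eapply Rle_lt_trans; [|exact Hn].
    apply Rmult_le_compat_r; [lra|apply Rmax_l]. }
  assert (H2 : (d - c) / 2 ^ n < del).
  { eapply Rle_lt_trans; [|exact Hn].
    apply Rmult_le_compat_r; [lra|apply Rmax_r]. }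
  generalize (Hinv n) (Hsize n) (Hx n) (Hy n).
  destruct (q n) as [[a' b'] [c' d']]; simpl.
  intros (h1 & h2 & h3 & h4 & h5 & h6 & h7) [s1 s2] [x1 x2] [y1 y2].
  exists n, a', b', c', d'. repeat split; try assumption; lra.
Qed.

(** Total differentiability of [P] and [Q] at one point, with a single [p2] standing for both dP/dy
    and dQ/dx: this sharing is the closedness of P dx + Q dy. *)
Definition closed_form_at (P Q : R -> R -> R) (x y : R) : Prop :=
  exists p1 p2 q2, forall eps, 0 < eps -> exists del, 0 < del /\
    forall x' y', Rabs (x' - x) < del -> Rabs (y' - y) < del ->
      Rabs (P x' y' - P x y - p1 * (x' - x) - p2 * (y' - y))
        <= eps * (Rabs (x' - x) + Rabs (y' - y)) /\
      Rabs (Q x' y' - Q x y - p2 * (x' - x) - q2 * (y' - y))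
        <= eps * (Rabs (x' - x) + Rabs (y' - y)).

Lemma continuous_of_linear_approx (f : R -> R) (x l : R) :
  (exists del, 0 < del /\ forall x', Rabs (x' - x) < del ->
     Rabs (f x' - f x - l * (x' - x)) <= 1 * Rabs (x' - x)) ->
  continuous f x.
Proof.
  intros [del [Hdel H]].
  apply continuity_pt_filterlim. intros eps Heps.
  set (K := Rabs l + 1).
  assert (HK : 0 < K) by (unfold K; pose proof (Rabs_pos l); lra).
  exists (Rmin del (eps / K)). split.
  { apply Rmin_pos; [exact Hdel|apply Rdiv_lt_0_compat; lra]. }
  intros x' [_ Hx']. simpl in *. unfold R_dist in *.
  assert (Hx1 : Rabs (x' - x) < del) by (eapply Rlt_le_trans; [exact Hx'|apply Rmin_l]).
  assert (Hx2 : Rabs (x' - x) < eps / K) by (eapply Rlt_le_trans; [exact Hx'|apply Rmin_r]).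
  specialize (H x' Hx1).
  replace (f x' - f x) with ((f x' - f x - l * (x' - x)) + l * (x' - x)) by ring.
  eapply Rle_lt_trans; [apply Rabs_triang|].
  rewrite Rabs_mult.
  apply Rle_lt_trans with (Rabs (x' - x) * K); [unfold K; lra|].
  apply (Rmult_lt_compat_r K) in Hx2; [|exact HK].
  replace (eps / K * K) with eps in Hx2 by (field; lra). exact Hx2.
Qed.

Lemma closed_form_at_continuous (P Q : R -> R -> R) (x y : R) :
  closed_form_at P Q x y ->
  continuous (fun x' => P x' y) x /\ continuous (fun y' => Q x y') y.
Proof.
  intros (p1 & p2 & q2 & H). destruct (H 1 Rlt_0_1) as [del [Hdel Hd]].
  split; [apply (continuous_of_linear_approx _ x p1)|apply (continuous_of_linear_approx _ y q2)];
    exists del; (split; [exact Hdel|]).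
  - intros x' Hx'. destruct (Hd x' y Hx') as [H1 _].
    { rewrite Rminus_diag, Rabs_R0; exact Hdel. }
    rewrite Rminus_diag, Rabs_R0 in H1.
    replace (P x' y - P x y - p1 * (x' - x)) with
      (P x' y - P x y - p1 * (x' - x) - p2 * 0) by ring. lra.
  - intros y' Hy'. destruct (Hd x y') as [_ H1]; [|exact Hy'|].
    { rewrite Rminus_diag, Rabs_R0; exact Hdel. }
    rewrite Rminus_diag, Rabs_R0 in H1.
    replace (Q x y' - Q x y - q2 * (y' - y)) with
      (Q x y' - Q x y - p2 * 0 - q2 * (y' - y)) by ring. lra.
Qed.

(** The integral of P dx + Q dy counterclockwise around the boundary, with opposite sides grouped
    into one integral each. *)
Definition circulation (P Q : R -> R -> R) (a b c d : R) : R :=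
  RInt (fun y => Q b y - Q a y) c d - RInt (fun x => P x d - P x c) a b.

Lemma RInt_near_const (f : R -> R) (a b k M : R) :
  a <= b -> ex_RInt f a b ->
  (forall t, a <= t <= b -> Rabs (f t - k) <= M) ->
  Rabs (RInt f a b - k * (b - a)) <= M * (b - a).
Proof.
  intros Hab Hf H.
  replace (RInt f a b - k * (b - a)) with (RInt (fun t => f t - k) a b).
  - rewrite (Rmult_comm M).
    apply abs_RInt_le_const; [exact Hab| |exact H].
    apply (ex_RInt_minus (V := R_NormedModule)); [exact Hf|apply ex_RInt_const].
  - rewrite (RInt_minus (V := R_CompleteNormedModule) f (fun _ => k));
      [|exact Hf|apply ex_RInt_const].
    rewrite RInt_const. unfold minus, plus, opp, scal; simpl. unfold mult; simpl. ring.
Qed.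

Definition closed_form_on (P Q : R -> R -> R) (a b c d : R) : Prop :=
  forall x y, a <= x <= b -> c <= y <= d -> closed_form_at P Q x y.

Lemma ex_RInt_horizontal (P Q : R -> R -> R) (a b c d u v y : R) :
  closed_form_on P Q a b c d -> a <= u -> u <= v -> v <= b -> c <= y <= d ->
  ex_RInt (fun x => P x y) u v.
Proof.
  intros Hcl; intros. apply (ex_RInt_continuous (V := R_CompleteNormedModule)).
  intros z Hz. rewrite Rmin_left, Rmax_right in Hz by lra.
  apply (closed_form_at_continuous P Q), Hcl; lra.
Qed.

Lemma ex_RInt_vertical (P Q : R -> R -> R) (a b c d u v x : R) :
  closed_form_on P Q a b c d -> c <= u -> u <= v -> v <= d -> a <= x <= b ->
  ex_RInt (fun y => Q x y) u v.
Proof.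
  intros Hcl; intros. apply (ex_RInt_continuous (V := R_CompleteNormedModule)).
  intros z Hz. rewrite Rmin_left, Rmax_right in Hz by lra.
  apply (closed_form_at_continuous P Q), Hcl; lra.
Qed.

(** Each of the four inner edges is traversed twice, in opposite directions, and cancels. *)
Lemma circulation_split (P Q : R -> R -> R) (a b c d a' m b' c' k d' : R) :
  closed_form_on P Q a b c d ->
  a <= a' -> a' <= m -> m <= b' -> b' <= b ->
  c <= c' -> c' <= k -> k <= d' -> d' <= d ->
  circulation P Q a' b' c' d' =
    circulation P Q a' m c' k + circulation P Q m b' c' k +
    circulation P Q a' m k d' + circulation P Q m b' k d'.
Proof.
  intros Hcl; intros. unfold circulation.
  assert (EP : forall u v y y', a <= u -> u <= v -> v <= b -> c <= y <= d -> c <= y' <= d ->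
    RInt (fun x => P x y - P x y') u v = RInt (fun x => P x y) u v - RInt (fun x => P x y') u v).
  { intros. apply (RInt_minus (V := R_CompleteNormedModule));
        apply (ex_RInt_horizontal P Q a b c d); (exact Hcl || lra). }
  assert (EQ : forall u v x x', c <= u -> u <= v -> v <= d -> a <= x <= b -> a <= x' <= b ->
    RInt (fun y => Q x y - Q x' y) u v = RInt (fun y => Q x y) u v - RInt (fun y => Q x' y) u v).
  { intros. apply (RInt_minus (V := R_CompleteNormedModule));
        apply (ex_RInt_vertical P Q a b c d); (exact Hcl || lra). }
  rewrite !EP, !EQ by lra.
  assert (CP : forall y, c <= y <= d ->
    RInt (fun x => P x y) a' b' = RInt (fun x => P x y) a' m + RInt (fun x => P x y) m b').
  { intros. symmetry. apply (RInt_Chasles (V := R_CompleteNormedModule));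
    apply (ex_RInt_horizontal P Q a b c d); (exact Hcl || lra). }
  assert (CQ : forall x, a <= x <= b ->
    RInt (fun y => Q x y) c' d' = RInt (fun y => Q x y) c' k + RInt (fun y => Q x y) k d').
  { intros. symmetry. apply (RInt_Chasles (V := R_CompleteNormedModule));
    apply (ex_RInt_vertical P Q a b c d); (exact Hcl || lra). }
  rewrite !CP, !CQ by lra. ring.
Qed.

(* Goursat's argument: the partial derivatives need not be continuous, nor even integrable. *)
Lemma circulation_closed_form (P Q : R -> R -> R) (a b c d : R) :
  closed_form_on P Q a b c d -> a < b -> c < d -> circulation P Q a b c d = 0.
Proof.
  intros Hcl Hab Hcd.
  destruct (Req_dec (circulation P Q a b c d) 0) as [|Hne]; [assumption|exfalso].
  set (W := b - a). set (H := d - c).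
  assert (HW : 0 < W) by (unfold W; lra). assert (HH : 0 < H) by (unfold H; lra).
  (* Half of the circulation per unit area; the factor 2 makes the strict inequality to be bisected
     true at the start. *)
  set (e := Rabs (circulation P Q a b c d) / (2 * (W * H))).
  assert (Hc0 := Rabs_pos_lt _ Hne).
  assert (HWH : 0 < W * H) by nra.
  assert (He : 0 < e) by (apply Rdiv_lt_0_compat; lra).
  destruct (rectangle_bisection
    (fun a' b' c' d' => e * ((b' - a') * (d' - c')) < Rabs (circulation P Q a' b' c' d'))
    a b c d) as (x & y & Hxy); [lra|lra| | |].
  - intros a' b' c' d' h1 h2 h3 h4 h5 h6 HS m k.
    rewrite (circulation_split P Q a b c d a' m b' c' k d') in HS
      by (exact Hcl || unfold m, k; lra).
    destruct (Rlt_le_dec (e * ((m - a') * (k - c'))) (Rabs (circulation P Q a' m c' k)));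
      [tauto|].
    destruct (Rlt_le_dec (e * ((b' - m) * (k - c'))) (Rabs (circulation P Q m b' c' k)));
      [tauto|].
    destruct (Rlt_le_dec (e * ((m - a') * (d' - k))) (Rabs (circulation P Q a' m k d')));
      [tauto|].
    destruct (Rlt_le_dec (e * ((b' - m) * (d' - k))) (Rabs (circulation P Q m b' k d')));
      [tauto|].
    exfalso.
    pose proof (Rabs_triang (circulation P Q a' m c' k + circulation P Q m b' c' k +
      circulation P Q a' m k d') (circulation P Q m b' k d')).
    pose proof (Rabs_triang (circulation P Q a' m c' k + circulation P Q m b' c' k)
      (circulation P Q a' m k d')).
    pose proof (Rabs_triang (circulation P Q a' m c' k) (circulation P Q m b' c' k)).
    assert (e * ((m - a') * (k - c')) + e * ((b' - m) * (k - c')) +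
      e * ((m - a') * (d' - k)) + e * ((b' - m) * (d' - k)) =
      e * ((b' - a') * (d' - c'))) by ring.
    lra.
  - fold W H. unfold e.
    replace (Rabs (circulation P Q a b c d) / (2 * (W * H)) * (W * H))
      with (Rabs (circulation P Q a b c d) / 2) by (field; split; lra).
    lra.
  - assert (Hx : a <= x <= b /\ c <= y <= d).
    { destruct (Hxy 1 Rlt_0_1) as (n & a' & b' & c' & d' & Hr). lra. }
    destruct (Hcl x y (proj1 Hx) (proj2 Hx)) as (p1 & p2 & q2 & Hd).
    (* Chosen so that 2 eps (w + h)^2 = e w h / 2 for every rectangle similar to the initial one,
       which is half of the lower bound that survived the bisection. *)
    set (eps := e * (W * H) / (4 * ((W + H) * (W + H)))).
    assert (Heps : 0 < eps).
    { apply Rdiv_lt_0_compat; nra. }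
    destruct (Hd eps Heps) as (del & Hdel & Happ).
    destruct (Hxy del Hdel) as (n & a' & b' & c' & d' & [Ha Hb] & [Hc Hd'] & Hs1 & Hs2 & HS).
    set (w := b' - a') in *. set (h := d' - c') in *.
    assert (Hw : 0 <= w) by (unfold w; lra). assert (Hh : 0 <= h) by (unfold h; lra).
    assert (Bd : forall x' y', a' <= x' <= b' -> c' <= y' <= d' ->
      Rabs (x' - x) < del /\ Rabs (y' - y) < del /\
      eps * (Rabs (x' - x) + Rabs (y' - y)) <= eps * (w + h)).
    { intros x' y' Hx' Hy'.
      assert (Rabs (x' - x) <= w) by (unfold w; apply Rabs_le; lra).
      assert (Rabs (y' - y) <= h) by (unfold h; apply Rabs_le; lra).
      repeat split; try lra. apply Rmult_le_compat_l; lra. }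
    (* In the difference of opposite sides the terms in [q2] cancel and [p2 * w] remains; the
       horizontal sides likewise leave [p2 * h]. Both integrate to [p2 * w * h], and closedness
       makes them cancel in the circulation. *)
    assert (HQ : Rabs (RInt (fun y => Q b' y - Q a' y) c' d' - (p2 * w) * (d' - c'))
      <= (2 * (eps * (w + h))) * (d' - c')).
    { apply RInt_near_const; [lra| |].
      - apply (ex_RInt_minus (V := R_NormedModule));
        apply (ex_RInt_vertical P Q a b c d); (exact Hcl || lra).
      - intros t Ht.
        destruct (Bd b' t ltac:(lra) Ht) as (u1 & u2 & u3).
        destruct (Bd a' t ltac:(lra) Ht) as (v1 & v2 & v3).
        destruct (Happ b' t u1 u2) as [_ k1]. destruct (Happ a' t v1 v2) as [_ k2].
        replace (Q b' t - Q a' t - p2 * w) with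
          ((Q b' t - Q x y - p2 * (b' - x) - q2 * (t - y)) +
           - (Q a' t - Q x y - p2 * (a' - x) - q2 * (t - y))) by (unfold w; ring).
        eapply Rle_trans; [apply Rabs_triang|]. rewrite Rabs_Ropp. lra. }
    assert (HP : Rabs (RInt (fun x => P x d' - P x c') a' b' - (p2 * h) * (b' - a'))
      <= (2 * (eps * (w + h))) * (b' - a')).
    { apply RInt_near_const; [lra| |].
      - apply (ex_RInt_minus (V := R_NormedModule));
        apply (ex_RInt_horizontal P Q a b c d); (exact Hcl || lra).
      - intros t Ht.
        destruct (Bd t d' Ht ltac:(lra)) as (u1 & u2 & u3).
        destruct (Bd t c' Ht ltac:(lra)) as (v1 & v2 & v3).
        destruct (Happ t d' u1 u2) as [k1 _]. destruct (Happ t c' v1 v2) as [k2 _].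
        replace (P t d' - P t c' - p2 * h) with
          ((P t d' - P x y - p1 * (t - x) - p2 * (d' - y)) +
           - (P t c' - P x y - p1 * (t - x) - p2 * (c' - y))) by (unfold h; ring).
        eapply Rle_trans; [apply Rabs_triang|]. rewrite Rabs_Ropp. lra. }
    fold w in HP. fold h in HQ.
    assert (Hcirc : Rabs (circulation P Q a' b' c' d') <= 2 * eps * ((w + h) * (w + h))).
    { unfold circulation.
      replace (RInt (fun y0 => Q b' y0 - Q a' y0) c' d' - RInt (fun x0 => P x0 d' - P x0 c') a' b')
        with ((RInt (fun y0 => Q b' y0 - Q a' y0) c' d' - p2 * w * h) +
          - (RInt (fun x0 => P x0 d' - P x0 c') a' b' - p2 * h * w)) by ring.
      eapply Rle_trans; [apply Rabs_triang|]. rewrite Rabs_Ropp. lra. }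
    fold W in Hs1. fold H in Hs2. destruct Hs1 as [Hs1 _]. destruct Hs2 as [Hs2 _].
    assert (Hp2 : 0 < 2 ^ n) by (apply pow_lt; lra).
    rewrite Hs1, Hs2 in HS, Hcirc.
    assert (E1 : 2 * eps * ((W / 2 ^ n + H / 2 ^ n) * (W / 2 ^ n + H / 2 ^ n)) =
      e * (W / 2 ^ n * (H / 2 ^ n)) / 2).
    { unfold eps. field. split; lra. }
    assert (0 < e * (W / 2 ^ n * (H / 2 ^ n))).
    { apply Rmult_lt_0_compat; [exact He|].
      apply Rmult_lt_0_compat; apply Rdiv_lt_0_compat; assumption. }
    lra.
Qed.

(** * Complex derivatives *)

Definition Cderiv (f : C -> C) (z l : C) : Prop :=
  forall eps, 0 < eps -> exists del, 0 < del /\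
    forall w, Cmod (w - z) < del ->
      Cmod (f w - f z - l * (w - z)) <= eps * Cmod (w - z).

Lemma Cderiv_is_derive (f : C -> C) (z l : C) :
  @is_derive C_AbsRing C_NormedModule f z l <-> Cderiv f z l.
Proof.
  split.
  - intros [_ H] eps Heps.
    assert (Hz : @is_filter_lim (AbsRing_NormedModule C_AbsRing)
      (@locally (AbsRing_NormedModule C_AbsRing) z) z)
      by (intros Pz HPz; exact HPz).
    destruct (H z Hz (mkposreal eps Heps)) as [del Hdel].
    exists del; split; [apply cond_pos|].
    intros w Hw. specialize (Hdel w Hw).
    rewrite (Cmult_comm l). exact Hdel.
  - intros H. split.
    + split.
      * intros x y. exact (Cmult_plus_distr_r x y l).
      * intros k x. symmetry. exact (Cmult_assoc k x l).
      * exists (Cmod l + 1). pose proof (Cmod_ge_0 l). split; [lra|].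
        intros x. change (Cmod (x * l) <= (Cmod l + 1) * Cmod x).
        rewrite Cmod_mult. pose proof (Cmod_ge_0 x). nra.
    + intros x Hx eps.
      apply (@is_filter_lim_locally_unique C_AbsRing (AbsRing_NormedModule C_AbsRing)) in Hx.
      subst x. destruct (H eps (cond_pos eps)) as [del [Hdel Hd]].
      exists (mkposreal del Hdel). intros w Hw.
      specialize (Hd w Hw). rewrite (Cmult_comm l) in Hd. exact Hd.
Qed.

Lemma Cderiv_lipschitz (f : C -> C) (z l : C) :
  Cderiv f z l -> exists del, 0 < del /\
    forall w, Cmod (w - z) < del -> Cmod (f w - f z) <= (Cmod l + 1) * Cmod (w - z).
Proof.
  intros H. destruct (H 1 Rlt_0_1) as [del [Hdel Hd]].
  exists del; split; [exact Hdel|]. intros w Hw. specialize (Hd w Hw).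
  replace (f w - f z)%C with ((f w - f z - l * (w - z)) + l * (w - z))%C by ring.
  eapply Rle_trans; [apply Cmod_triangle|]. rewrite Cmod_mult. lra.
Qed.

Lemma Cderiv_const (k z : C) : Cderiv (fun _ => k) z 0.
Proof.
  intros eps Heps. exists 1; split; [lra|]. intros w _.
  replace (k - k - 0 * (w - z))%C with (RtoC 0) by ring.
  rewrite Cmod_0. apply Rmult_le_pos; [lra|apply Cmod_ge_0].
Qed.

Lemma Cderiv_scal_id (k z : C) : Cderiv (fun w => k * w)%C z k.
Proof.
  intros eps Heps. exists 1; split; [lra|]. intros w _.
  replace (k * w - k * z - k * (w - z))%C with (RtoC 0) by ring.
  rewrite Cmod_0. apply Rmult_le_pos; [lra|apply Cmod_ge_0].
Qed.

Lemma Cderiv_mult (f g : C -> C) (z l m : C) :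
  Cderiv f z l -> Cderiv g z m ->
  Cderiv (fun w => f w * g w)%C z (l * g z + f z * m)%C.
Proof.
  intros Hf Hg eps Heps.
  destruct (Cderiv_lipschitz f z l Hf) as [d1 [Hd1 L1]].
  destruct (Cderiv_lipschitz g z m Hg) as [d2 [Hd2 L2]].
  set (K := (Cmod l + 1) * (Cmod m + 1)).
  set (A := Cmod (g z) + 1). set (B := Cmod (f z) + 1).
  pose proof (Cmod_ge_0 l). pose proof (Cmod_ge_0 m).
  pose proof (Cmod_ge_0 (f z)). pose proof (Cmod_ge_0 (g z)).
  assert (HK : 0 < K) by (unfold K; nra).
  assert (HA : 0 < A) by (unfold A; lra). assert (HB : 0 < B) by (unfold B; lra).
  destruct (Hf (eps / (3 * A))) as [d3 [Hd3 F]]; [apply Rdiv_lt_0_compat; lra|].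
  destruct (Hg (eps / (3 * B))) as [d4 [Hd4 G]]; [apply Rdiv_lt_0_compat; lra|].
  exists (Rmin (Rmin d1 d2) (Rmin (Rmin d3 d4) (eps / (3 * K)))). split.
  { repeat apply Rmin_pos; try assumption. apply Rdiv_lt_0_compat; lra. }
  intros w Hw.
  apply Rmin_Rgt_l in Hw. destruct Hw as [Hw1 Hw2].
  apply Rmin_Rgt_l in Hw1. apply Rmin_Rgt_l in Hw2. destruct Hw1 as [Hw1 Hw1'].
  destruct Hw2 as [Hw2 Hw3]. apply Rmin_Rgt_l in Hw2. destruct Hw2 as [Hw2 Hw2'].
  specialize (L1 w Hw1). specialize (L2 w Hw1'). specialize (F w Hw2). specialize (G w Hw2').
  set (h := Cmod (w - z)) in *.
  assert (Hh : 0 <= h) by apply Cmod_ge_0.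
  (* Two first-order errors and a product of increments; the latter is at most [K * h * h] by the
     Lipschitz bounds, hence the radius [eps / (3 * K)]. *)
  replace (f w * g w - f z * g z - (l * g z + f z * m) * (w - z))%C with
    ((f w - f z - l * (w - z)) * g z + f z * (g w - g z - m * (w - z)) +
     (f w - f z) * (g w - g z))%C by ring.
  eapply Rle_trans; [apply Cmod_triangle|].
  eapply Rle_trans; [apply Rplus_le_compat_r, Cmod_triangle|].
  rewrite !Cmod_mult.
  assert (T1 : Cmod (f w - f z - l * (w - z)) * Cmod (g z) <= eps / 3 * h).
  { apply Rle_trans with (eps / (3 * A) * h * A).
    - apply Rmult_le_compat; try apply Cmod_ge_0; [exact F|unfold A; lra].
    - apply Req_le. field. lra. }
  assert (T2 : Cmod (f z) * Cmod (g w - g z - m * (w - z)) <= eps / 3 * h).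
  { apply Rle_trans with (B * (eps / (3 * B) * h)).
    - apply Rmult_le_compat; try apply Cmod_ge_0; [unfold B; lra|exact G].
    - apply Req_le. field. lra. }
  assert (T3 : Cmod (f w - f z) * Cmod (g w - g z) <= eps / 3 * h).
  { apply Rle_trans with (((Cmod l + 1) * h) * ((Cmod m + 1) * h)).
    - apply Rmult_le_compat; try apply Cmod_ge_0; assumption.
    - replace ((Cmod l + 1) * h * ((Cmod m + 1) * h)) with (K * h * h) by (unfold K; ring).
      apply Rmult_le_compat_r; [exact Hh|].
      replace (eps / 3) with (K * (eps / (3 * K))) by (field; lra).
      apply Rmult_le_compat_l; lra. }
  lra.
Qed.

Lemma Cderiv_comp (f g : C -> C) (z l m : C) :
  Cderiv f z l -> Cderiv g (f z) m -> Cderiv (fun w => g (f w)) z (m * l)%C.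
Proof.
  intros Hf Hg eps Heps.
  destruct (Cderiv_lipschitz f z l Hf) as [d1 [Hd1 L1]].
  set (K := Cmod l + 1) in *. set (B := Cmod m + 1).
  pose proof (Cmod_ge_0 l). pose proof (Cmod_ge_0 m).
  assert (HK : 0 < K) by (unfold K; lra). assert (HB : 0 < B) by (unfold B; lra).
  destruct (Hg (eps / (2 * K))) as [d2 [Hd2 G]]; [apply Rdiv_lt_0_compat; lra|].
  destruct (Hf (eps / (2 * B))) as [d3 [Hd3 F]]; [apply Rdiv_lt_0_compat; lra|].
  exists (Rmin (Rmin d1 d3) (d2 / K)). split.
  { repeat apply Rmin_pos; try assumption. apply Rdiv_lt_0_compat; lra. }
  intros w Hw. apply Rmin_Rgt_l in Hw. destruct Hw as [Hw1 Hw2].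
  apply Rmin_Rgt_l in Hw1. destruct Hw1 as [Hw1 Hw3].
  specialize (L1 w Hw1). specialize (F w Hw3).
  set (h := Cmod (w - z)) in *.
  assert (Hh : 0 <= h) by apply Cmod_ge_0.
  assert (HG : Cmod (f w - f z) < d2).
  { eapply Rle_lt_trans; [exact L1|].
    replace d2 with (K * (d2 / K)) by (field; lra). apply Rmult_lt_compat_l; lra. }
  specialize (G (f w) HG).
  replace (g (f w) - g (f z) - m * l * (w - z))%C with
    ((g (f w) - g (f z) - m * (f w - f z)) + m * (f w - f z - l * (w - z)))%C by ring.
  eapply Rle_trans; [apply Cmod_triangle|]. rewrite Cmod_mult.
  assert (T1 : eps / (2 * K) * Cmod (f w - f z) <= eps / 2 * h).
  { replace (eps / 2 * h) with (eps / (2 * K) * (K * h)) by (field; lra).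
    apply Rmult_le_compat_l; [|exact L1].
    apply Rlt_le, Rdiv_lt_0_compat; lra. }
  assert (T2 : Cmod m * Cmod (f w - f z - l * (w - z)) <= eps / 2 * h).
  { replace (eps / 2 * h) with (B * (eps / (2 * B) * h)) by (field; lra).
    apply Rmult_le_compat; try apply Cmod_ge_0; [unfold B; lra|exact F]. }
  lra.
Qed.

Lemma ex_Cderiv_pow (f : C -> C) (z : C) (n : nat) :
  (exists l, Cderiv f z l) -> exists l, Cderiv (fun w => Cpow (f w) n) z l.
Proof.
  intros [l Hl]. induction n as [|n [m Hm]].
  - exists 0. exact (Cderiv_const 1 z).
  - eexists. exact (Cderiv_mult f (fun w => Cpow (f w) n) z l m Hl Hm).
Qed.

Lemma Rabs_snd_le_Cmod (z : C) : Rabs (snd z) <= Cmod z.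
Proof. eapply Rle_trans; [apply Rmax_r|apply Rmax_Cmod]. Qed.

Lemma Cmod_le_Rabs (z : C) : Cmod z <= Rabs (fst z) + Rabs (snd z).
Proof.
  destruct z as [x y]. simpl.
  replace (x, y) with (RtoC x + Ci * RtoC y)%C
    by (unfold RtoC, Ci, Cplus, Cmult; simpl; f_equal; ring).
  eapply Rle_trans; [apply Cmod_triangle|].
  rewrite Cmod_mult, Cmod_Ci, !Cmod_R. lra.
Qed.

(** * The complex exponential and closed forms Im (F dw) *)

Definition Cexp (w : C) : C := (exp (fst w) * cos (snd w), exp (fst w) * sin (snd w)).

Lemma Cexp_plus (w w' : C) : Cexp (w + w') = (Cexp w * Cexp w')%C.
Proof.
  unfold Cexp, Cplus, Cmult; simpl. rewrite exp_plus, cos_plus, sin_plus.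
  f_equal; ring.
Qed.

Lemma Cmod_Cexp (w : C) : Cmod (Cexp w) = exp (fst w).
Proof.
  unfold Cmod, Cexp; simpl fst; simpl snd.
  replace ((exp (fst w) * cos (snd w)) ^ 2 + (exp (fst w) * sin (snd w)) ^ 2)
    with (exp (fst w) ^ 2 * (Rsqr (sin (snd w)) + Rsqr (cos (snd w)))) by (unfold Rsqr; ring).
  rewrite sin2_cos2, Rmult_1_r.
  rewrite sqrt_pow2; [reflexivity|]. apply Rlt_le, exp_pos.
Qed.

Lemma derivable_pt_lim_approx (f : R -> R) (l : R) :
  derivable_pt_lim f 0 l -> forall eps, 0 < eps -> exists del, 0 < del /\
    forall h, Rabs h < del -> Rabs (f h - f 0 - l * h) <= eps * Rabs h.
Proof.
  intros H eps Heps. destruct (H eps Heps) as [del Hd].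
  exists del; split; [apply cond_pos|]. intros h Hh.
  destruct (Req_dec h 0) as [->|Hne].
  - rewrite Rmult_0_r, Rminus_0_r, Rminus_diag, Rabs_R0. lra.
  - specialize (Hd h Hne Hh). rewrite Rplus_0_l in Hd.
    replace (f h - f 0 - l * h) with (((f h - f 0) / h - l) * h) by (field; exact Hne).
    rewrite Rabs_mult. apply Rmult_le_compat_r; [apply Rabs_pos|lra].
Qed.

Lemma Cderiv_Cexp_0 : Cderiv Cexp 0 1.
Proof.
  intros eps Heps.
  (* The errors below add up to [e * Rabs x + 7 * (e * Rabs y)], at most [8 * e * h]. The bound
     [e <= 1] gives [Rabs (exp x - 1) <= 2 * Rabs x] and, with [Rabs x < e], the factor 2 that
     bounds [1 + x]. *)
  set (e := Rmin 1 (eps / 8)).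
  assert (He : 0 < e) by (apply Rmin_pos; lra).
  assert (He1 : e <= 1) by apply Rmin_l.
  assert (He8 : 8 * e <= eps) by (pose proof (Rmin_r 1 (eps / 8)); unfold e; lra).
  clearbody e.
  pose proof (derivable_pt_lim_exp 0) as D1. rewrite exp_0 in D1.
  pose proof (derivable_pt_lim_cos 0) as D2. rewrite sin_0, Ropp_0 in D2.
  pose proof (derivable_pt_lim_sin 0) as D3. rewrite cos_0 in D3.
  destruct (derivable_pt_lim_approx _ _ D1 e He) as [d1 [Hd1 E1]].
  destruct (derivable_pt_lim_approx _ _ D2 e He) as [d2 [Hd2 E2]].
  destruct (derivable_pt_lim_approx _ _ D3 e He) as [d3 [Hd3 E3]].
  exists (Rmin (Rmin d1 e) (Rmin d2 d3)). split; [repeat apply Rmin_pos; assumption|].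
  intros w Hw. replace (w - 0)%C with w in * by ring.
  apply Rmin_Rgt_l in Hw. destruct Hw as [Hw1 Hw2].
  apply Rmin_Rgt_l in Hw1. apply Rmin_Rgt_l in Hw2.
  pose proof (re_le_Cmod w) as Hx. pose proof (Rabs_snd_le_Cmod w) as Hy.
  destruct w as [x y]. unfold Re in Hx. simpl fst in *; simpl snd in *.
  set (h := Cmod (x, y)) in *.
  specialize (E1 x ltac:(lra)). specialize (E2 y ltac:(lra)). specialize (E3 y ltac:(lra)).
  rewrite exp_0 in E1. rewrite cos_0 in E2. rewrite sin_0 in E3.
  pose proof (Rabs_pos x). pose proof (Rabs_pos y).
  assert (Ex : Rabs (exp x - 1) <= 2 * Rabs x).
  { replace (exp x - 1) with ((exp x - 1 - 1 * x) + x) by ring.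
    eapply Rle_trans; [apply Rabs_triang|]. nra. }
  assert (Sy : Rabs (sin y) <= 2 * Rabs y).
  { replace (sin y) with ((sin y - 0 - 1 * y) + y) by ring.
    eapply Rle_trans; [apply Rabs_triang|]. nra. }
  assert (Cy : Rabs (cos y) <= 1) by (apply Rabs_le; pose proof (COS_bound y); lra).
  eapply Rle_trans; [apply Cmod_le_Rabs|].
  unfold Cexp, Cminus, Cplus, Copp, Cmult, RtoC; simpl.
  rewrite exp_0, cos_0, sin_0.
  replace (exp x * cos y + - (1 * 1) + - (1 * x - 0 * y)) with
    ((exp x - 1 - 1 * x) * cos y + (1 + x) * (cos y - 1 - 0 * y)) by ring.
  replace (exp x * sin y + - (1 * 0) + - (1 * y + 0 * x)) with
    ((exp x - 1) * sin y + (sin y - 0 - 1 * y)) by ring.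
  assert (T1 : Rabs ((exp x - 1 - 1 * x) * cos y) <= e * Rabs x).
  { rewrite Rabs_mult. rewrite <- (Rmult_1_r (e * Rabs x)).
    apply Rmult_le_compat; try apply Rabs_pos; assumption. }
  assert (T2 : Rabs ((1 + x) * (cos y - 1 - 0 * y)) <= 2 * (e * Rabs y)).
  { rewrite Rabs_mult. apply Rmult_le_compat; try apply Rabs_pos; [|assumption].
    eapply Rle_trans; [apply Rabs_triang|]. rewrite Rabs_R1. lra. }
  assert (T3 : Rabs ((exp x - 1) * sin y) <= (2 * e) * (2 * Rabs y)).
  { rewrite Rabs_mult. apply Rmult_le_compat; try apply Rabs_pos; [lra|assumption]. }
  pose proof (Rabs_triang ((exp x - 1 - 1 * x) * cos y) ((1 + x) * (cos y - 1 - 0 * y))).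
  pose proof (Rabs_triang ((exp x - 1) * sin y) (sin y - 0 - 1 * y)).
  assert (Hh : 0 <= h) by apply Cmod_ge_0.
  assert (e * Rabs x <= e * h) by (apply Rmult_le_compat_l; lra).
  assert (e * Rabs y <= e * h) by (apply Rmult_le_compat_l; lra).
  assert (8 * e * h <= eps * h) by (apply Rmult_le_compat_r; lra).
  lra.
Qed.

(** The addition law carries the derivative from 0 to [w]; the error is scaled by
    [Cmod (Cexp w)]. *)
Lemma Cderiv_Cexp (w : C) : Cderiv Cexp w (Cexp w).
Proof.
  intros eps Heps. assert (Hp : 0 < Cmod (Cexp w)) by (rewrite Cmod_Cexp; apply exp_pos).
  destruct (Cderiv_Cexp_0 (eps / Cmod (Cexp w))) as [del [Hdel Hd]].
  { apply Rdiv_lt_0_compat; assumption. }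
  exists del; split; [exact Hdel|]. intros w' Hw'.
  specialize (Hd (w' - w)%C). replace (w' - w - 0)%C with (w' - w)%C in Hd by ring.
  specialize (Hd Hw').
  assert (E0 : Cexp 0 = 1).
  { unfold Cexp, RtoC; simpl. rewrite exp_0, cos_0, sin_0. f_equal; ring. }
  rewrite E0 in Hd.
  replace (Cexp w') with (Cexp w * Cexp (w' - w))%C
    by (rewrite <- Cexp_plus; f_equal; ring).
  replace (Cexp w * Cexp (w' - w) - Cexp w - Cexp w * (w' - w))%C with
    (Cexp w * (Cexp (w' - w) - 1 - 1 * (w' - w)))%C by ring.
  rewrite Cmod_mult.
  replace (eps * Cmod (w' - w)) with
    (Cmod (Cexp w) * (eps / Cmod (Cexp w) * Cmod (w' - w))) by (field; lra).
  apply Rmult_le_compat_l; [lra|exact Hd].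
Qed.

(** The form is Im (F dw) with w = x + i y. For F' = u + i v the Cauchy-Riemann equations give d(Im
    F) = v dx + u dy and d(Re F) = u dx - v dy, with the common coefficient u. *)
Lemma Cderiv_closed_form (F : C -> C) (x y : R) :
  (exists l, Cderiv F (x, y) l) ->
  closed_form_at (fun x y => Im (F (x, y))) (fun x y => Re (F (x, y))) x y.
Proof.
  intros [[u v] H]. exists v, u, (- v). intros eps Heps.
  destruct (H eps Heps) as [del [Hdel Hd]].
  exists (del / 2). split; [lra|]. intros x' y' Hx Hy.
  assert (Hm : Cmod ((x', y') - (x, y)) <= Rabs (x' - x) + Rabs (y' - y)).
  { apply Cmod_le_Rabs. }
  specialize (Hd (x', y') ltac:(lra)).
  assert (Hb : Cmod (F (x', y') - F (x, y) - (u, v) * ((x', y') - (x, y))) <=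
    eps * (Rabs (x' - x) + Rabs (y' - y))).
  { eapply Rle_trans; [exact Hd|]. apply Rmult_le_compat_l; lra. }
  split; (eapply Rle_trans; [|exact Hb]).
  - eapply Rle_trans; [|apply Rabs_snd_le_Cmod].
    apply Req_le. f_equal. unfold Im. simpl. ring.
  - eapply Rle_trans; [|apply re_le_Cmod].
    apply Req_le. f_equal. unfold Re. simpl. ring.
Qed.

(** By periodicity the two horizontal sides of the rectangle cancel, so zero circulation of Im (F
    dw) equates the vertical sides, where dw = i dt turns the form into Re F dt. *)
Lemma RInt_Re_periodic_strip (F : C -> C) (s1 s2 : R) :
  (forall w, fst w < 0 -> exists l, Cderiv F w l) ->
  (forall s t, F (s, t + 2 * PI) = F (s, t)) ->
  s1 < s2 -> s2 < 0 ->
  RInt (fun t => Re (F (s1, t))) 0 (2 * PI) = RInt (fun t => Re (F (s2, t))) 0 (2 * PI).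
Proof.
  intros HF Hper H12 H2. pose proof PI_RGT_0.
  set (P := fun x y => Im (F (x, y))). set (Q := fun x y => Re (F (x, y))).
  assert (Hcl : closed_form_on P Q s1 s2 0 (2 * PI)).
  { intros x y Hx Hy. apply Cderiv_closed_form, HF. simpl. lra. }
  assert (Hc := circulation_closed_form P Q s1 s2 0 (2 * PI) Hcl H12 ltac:(lra)).
  unfold circulation in Hc.
  rewrite (RInt_ext (fun x => P x (2 * PI) - P x 0) (fun _ => 0)) in Hc.
  2: { intros x _. unfold P. rewrite <- (Rplus_0_l (2 * PI)), Hper. exact (Rminus_diag _). }
  rewrite RInt_const in Hc.
  rewrite (RInt_minus (V := R_CompleteNormedModule) (Q s2) (Q s1)) in Hc;
    try (apply (ex_RInt_vertical P Q s1 s2 0 (2 * PI)); (exact Hcl || lra)).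
  unfold minus, plus, opp, scal in Hc; simpl in Hc. unfold mult in Hc; simpl in Hc.
  fold (Q s1) (Q s2). lra.
Qed.

(** * Fourier coefficients and Bessel's inequality *)

Definition Rmean (g : R -> R) : R := RInt g 0 (2 * PI) / (2 * PI).

Lemma ex_RInt_cont (g : R -> R) (a b : R) : (forall t, continuous g t) -> ex_RInt g a b.
Proof.
  intros H. apply (ex_RInt_continuous (V := R_CompleteNormedModule)). intros; apply H.
Qed.

Lemma Rmean_ext (g h : R -> R) : (forall t, g t = h t) -> Rmean g = Rmean h.
Proof. intros H. unfold Rmean. f_equal. apply RInt_ext. intros; apply H. Qed.

Lemma Rmean_plus (g h : R -> R) :
  (forall t, continuous g t) -> (forall t, continuous h t) ->
  Rmean (fun t => g t + h t) = Rmean g + Rmean h.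
Proof.
  intros Hg Hh. unfold Rmean.
  rewrite (RInt_plus (V := R_CompleteNormedModule) g h) by (apply ex_RInt_cont; assumption).
  unfold plus; simpl. lra.
Qed.

Lemma Rmean_scal (c : R) (g : R -> R) :
  (forall t, continuous g t) -> Rmean (fun t => c * g t) = c * Rmean g.
Proof.
  intros Hg. unfold Rmean.
  rewrite (RInt_scal (V := R_CompleteNormedModule) g) by (apply ex_RInt_cont; assumption).
  unfold scal; simpl; unfold mult; simpl. lra.
Qed.

Lemma Rmean_const (c : R) : Rmean (fun _ => c) = c.
Proof.
  unfold Rmean. rewrite RInt_const. unfold scal; simpl; unfold mult; simpl.
  pose proof PI_RGT_0. field. lra.
Qed.

Lemma Rmean_le (g h : R -> R) :
  (forall t, continuous g t) -> (forall t, continuous h t) ->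
  (forall t, g t <= h t) -> Rmean g <= Rmean h.
Proof.
  intros Hg Hh H. pose proof PI_RGT_0. unfold Rmean.
  apply Rmult_le_compat_r; [apply Rlt_le, Rinv_0_lt_compat; lra|].
  apply RInt_le; [lra|apply ex_RInt_cont; assumption|apply ex_RInt_cont; assumption|].
  intros; apply H.
Qed.

Definition Ccont (f : R -> C) : Prop :=
  forall t, continuous (fun t => Re (f t)) t /\ continuous (fun t => Im (f t)) t.

Lemma Ccont_const (c : C) : Ccont (fun _ => c).
Proof. intros t; split; apply continuous_const. Qed.

Lemma Ccont_plus (f g : R -> C) : Ccont f -> Ccont g -> Ccont (fun t => f t + g t)%C.
Proof.
  intros Hf Hg t. destruct (Hf t), (Hg t).
  split; apply (continuous_plus (V := R_NormedModule)); assumption.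
Qed.

Lemma Ccont_mult (f g : R -> C) : Ccont f -> Ccont g -> Ccont (fun t => f t * g t)%C.
Proof.
  intros Hf Hg t. destruct (Hf t), (Hg t). split.
  - apply (continuous_minus (V := R_NormedModule));
      apply (continuous_mult (K := R_AbsRing)); assumption.
  - apply (continuous_plus (V := R_NormedModule));
      apply (continuous_mult (K := R_AbsRing)); assumption.
Qed.

Lemma Ccont_Cmod2 (f : R -> C) : Ccont f -> forall t, continuous (fun t => Cmod (f t) ^ 2) t.
Proof.
  intros Hf t. destruct (Hf t).
  apply (continuous_ext (fun t => Re (f t) * Re (f t) + Im (f t) * Im (f t))).
  { intros; rewrite Cmod2_alt; simpl. unfold plus; simpl. ring. }
  apply (continuous_plus (V := R_NormedModule));
    apply (continuous_mult (K := R_AbsRing)); assumption.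
Qed.

Definition Cmean (f : R -> C) : C :=
  (Rmean (fun t => Re (f t)), Rmean (fun t => Im (f t))).

Lemma Cmean_ext (f g : R -> C) : (forall t, f t = g t) -> Cmean f = Cmean g.
Proof.
  intros H; unfold Cmean; f_equal; apply Rmean_ext; intros t; rewrite H; reflexivity.
Qed.

Lemma Cmean_plus (f g : R -> C) :
  Ccont f -> Ccont g -> Cmean (fun t => f t + g t)%C = (Cmean f + Cmean g)%C.
Proof.
  intros Hf Hg. unfold Cmean, Cplus at 3; simpl. f_equal.
  - rewrite <- Rmean_plus by (intros t; apply Hf || apply Hg). reflexivity.
  - rewrite <- Rmean_plus by (intros t; apply Hf || apply Hg). reflexivity.
Qed.

Lemma Cmean_scal (c : C) (f : R -> C) :
  Ccont f -> Cmean (fun t => c * f t)%C = (c * Cmean f)%C.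
Proof.
  intros Hf. unfold Cmean, Cmult at 3; simpl.
  assert (K : forall (k : R) (g : R -> R), (forall t, continuous g t) ->
    forall t, continuous (fun t => k * g t) t).
  { intros k g Hg t. apply (continuous_mult (K := R_AbsRing)); [apply continuous_const|apply Hg]. }
  assert (H1 : forall t, continuous (fun t => Re (f t)) t) by (intros t; apply Hf).
  assert (H2 : forall t, continuous (fun t => Im (f t)) t) by (intros t; apply Hf).
  f_equal.
  - rewrite (Rmean_ext _ (fun t => fst c * Re (f t) + (- snd c) * Im (f t)))
      by (intros t; simpl; unfold Re, Im; ring).
    rewrite Rmean_plus by (apply K; assumption).
    rewrite !Rmean_scal by assumption. ring.
  - rewrite (Rmean_ext _ (fun t => fst c * Im (f t) + snd c * Re (f t)))
      by (intros t; simpl; unfold Re, Im; ring).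
    rewrite Rmean_plus by (apply K; assumption).
    rewrite !Rmean_scal by assumption. ring.
Qed.

Definition cis (k : Z) (t : R) : C := (cos (IZR k * t), sin (IZR k * t)).

Lemma cis_plus (j k : Z) (t : R) : cis (j + k) t = (cis j t * cis k t)%C.
Proof.
  unfold cis, Cmult; simpl.
  rewrite plus_IZR, Rmult_plus_distr_r, cos_plus, sin_plus. f_equal; ring.
Qed.

Lemma cis_0 (t : R) : cis 0 t = 1.
Proof. unfold cis, RtoC. rewrite Rmult_0_l, cos_0, sin_0. reflexivity. Qed.

Lemma Cmod_cis (k : Z) (t : R) : Cmod (cis k t) = 1.
Proof.
  unfold Cmod, cis; simpl fst; simpl snd.
  replace (cos (IZR k * t) ^ 2 + sin (IZR k * t) ^ 2) with 1; [apply sqrt_1|].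
  pose proof (sin2_cos2 (IZR k * t)) as H. unfold Rsqr in H. rewrite <- H. ring.
Qed.

Lemma Cconj_cis (k : Z) (t : R) : Cconj (cis k t) = cis (- k) t.
Proof.
  unfold Cconj, cis; simpl. rewrite opp_IZR, <- Ropp_mult_distr_l, cos_neg, sin_neg.
  reflexivity.
Qed.

Lemma Ccont_cis (k : Z) : Ccont (cis k).
Proof.
  intros t. split; apply (ex_derive_continuous (K := R_AbsRing) (V := R_NormedModule));
    unfold cis, Re, Im; simpl; auto_derive; trivial.
Qed.

Lemma sin_2kPI (k : Z) : sin (IZR k * (2 * PI)) = 0.
Proof. apply sin_eq_0_1. exists (2 * k)%Z. rewrite mult_IZR. ring. Qed.

Lemma cos_2kPI (k : Z) : cos (IZR k * (2 * PI)) = 1.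
Proof.
  replace (IZR k * (2 * PI)) with (2 * (IZR k * PI)) by ring.
  rewrite cos_2a_sin, (sin_eq_0_1 (IZR k * PI)) by (exists k; reflexivity). ring.
Qed.

Lemma cis_period (k : Z) (t : R) : cis k (t + 2 * PI) = cis k t.
Proof.
  unfold cis. rewrite Rmult_plus_distr_l, cos_plus, sin_plus, sin_2kPI, cos_2kPI.
  f_equal; ring.
Qed.

Lemma Cmean_cis (k : Z) : k <> 0%Z -> Cmean (cis k) = 0.
Proof.
  intros Hk. apply not_0_IZR in Hk. unfold Cmean, RtoC, Rmean. f_equal.
  - replace (RInt _ 0 (2 * PI)) with 0; [lra|]. symmetry.
    apply is_RInt_unique.
    replace 0 with (minus (sin (IZR k * (2 * PI)) / IZR k) (sin (IZR k * 0) / IZR k)) at 2.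
    2: { rewrite sin_2kPI, Rmult_0_r, sin_0. apply Rminus_diag. }
    apply (is_RInt_derive (V := R_CompleteNormedModule) (fun t => sin (IZR k * t) / IZR k)).
    + intros x _. unfold cis, Re; simpl. auto_derive; trivial. field. exact Hk.
    + intros x _. apply (Ccont_cis k x).
  - replace (RInt _ 0 (2 * PI)) with 0; [lra|]. symmetry.
    apply is_RInt_unique.
    replace 0 with (minus (- cos (IZR k * (2 * PI)) / IZR k) (- cos (IZR k * 0) / IZR k)) at 2.
    2: { rewrite cos_2kPI, Rmult_0_r, cos_0. apply Rminus_diag. }
    apply (is_RInt_derive (V := R_CompleteNormedModule) (fun t => - cos (IZR k * t) / IZR k)).
    + intros x _. unfold cis, Im; simpl. auto_derive; trivial. field. exact Hk.
    + intros x _. apply (Ccont_cis k x).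
Qed.

Definition fourier (f : R -> C) (k : Z) : C := Cmean (fun t => f t * cis (- k) t)%C.

Lemma fourier_plus (f g : R -> C) (k : Z) :
  Ccont f -> Ccont g -> fourier (fun t => f t + g t)%C k = (fourier f k + fourier g k)%C.
Proof.
  intros Hf Hg. unfold fourier.
  rewrite <- Cmean_plus by (apply Ccont_mult; [assumption|apply Ccont_cis]).
  apply Cmean_ext. intros t; ring.
Qed.

Lemma fourier_scal (c : C) (f : R -> C) (k : Z) :
  Ccont f -> fourier (fun t => c * f t)%C k = (c * fourier f k)%C.
Proof.
  intros Hf. unfold fourier.
  rewrite <- Cmean_scal by (apply Ccont_mult; [assumption|apply Ccont_cis]).
  apply Cmean_ext. intros t; ring.
Qed.

Lemma fourier_cis (j k : Z) :
  fourier (cis j) k = if Z.eq_dec j k then 1 else 0.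
Proof.
  unfold fourier. rewrite (Cmean_ext _ (cis (j - k))).
  2: { intros t. unfold Z.sub. rewrite cis_plus. reflexivity. }
  destruct (Z.eq_dec j k) as [->|Hjk].
  - rewrite Z.sub_diag. rewrite (Cmean_ext _ (fun _ => RtoC 1)) by apply cis_0.
    unfold Cmean, RtoC; simpl. rewrite !Rmean_const. reflexivity.
  - apply Cmean_cis. lia.
Qed.

Lemma fourier_mult_cis (f : R -> C) (j k : Z) :
  fourier (fun t => cis j t * f t)%C k = fourier f (k - j).
Proof.
  unfold fourier. apply Cmean_ext. intros t.
  replace (- (k - j))%Z with (j + - k)%Z by lia. rewrite cis_plus. ring.
Qed.

(** Pythagoras in mean square: [cis k] is a unit vector, and [fourier f k * cis k] is the orthogonal
    projection of [f] on it. *)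
Lemma Rmean_Cmod2_sub_fourier (f : R -> C) (k : Z) :
  Ccont f ->
  Rmean (fun t => Cmod (f t + - fourier f k * cis k t) ^ 2) =
  Rmean (fun t => Cmod (f t) ^ 2) - Cmod (fourier f k) ^ 2.
Proof.
  intros Hf. set (d := fourier f k).
  set (g := fun t => (Cconj d * (f t * cis (- k) t))%C).
  assert (Hg0 : Ccont (fun t => f t * cis (- k) t)%C)
    by (apply Ccont_mult; [exact Hf|apply Ccont_cis]).
  assert (Hg : Ccont g) by (apply Ccont_mult; [apply Ccont_const|exact Hg0]).
  rewrite (Rmean_ext _ (fun t => (Cmod (f t) ^ 2 + (-2) * Re (g t)) + Cmod d ^ 2)).
  - assert (H1 : forall t, continuous (fun t => Re (g t)) t) by (intros t; apply Hg).
    assert (H2 : forall t, continuous (fun t => -2 * Re (g t)) t).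
    { intros t. apply (continuous_mult (K := R_AbsRing)); [apply continuous_const|apply H1]. }
    rewrite (Rmean_plus _ (fun _ => Cmod d ^ 2)).
    2: { intros t. apply (continuous_plus (V := R_NormedModule));
         [apply Ccont_Cmod2; exact Hf|apply H2]. }
    2: { intros t; apply continuous_const. }
    rewrite Rmean_plus by (apply Ccont_Cmod2 || apply H2; exact Hf).
    rewrite Rmean_scal, Rmean_const by exact H1.
    change (Rmean (fun t => Re (g t))) with (Re (Cmean g)).
    unfold g. rewrite Cmean_scal by exact Hg0. fold (fourier f k) d.
    rewrite Cmod2_alt, re_mult, re_conj, im_conj. ring.
  - intros t. unfold g. rewrite <- Cconj_cis.
    pose proof (Cmod_cis k t) as Hc.
    assert (Hc2 : Re (cis k t) ^ 2 + Im (cis k t) ^ 2 = 1) by (rewrite <- Cmod2_alt, Hc; ring).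
    rewrite !Cmod2_alt.
    destruct (f t) as [u v]. destruct d as [p q]. destruct (cis k t) as [x y].
    unfold Re, Im in *; simpl in *.
    (* Multiplying |d|^2 by |cis k t|^2 = 1 turns the goal into a polynomial identity. *)
    replace (p * (p * 1) + q * (q * 1)) with
      ((p * (p * 1) + q * (q * 1)) * (x * (x * 1) + y * (y * 1))) by (rewrite Hc2; ring).
    ring.
Qed.

(** Removing the projection on [cis (sigma 0)] lowers the mean square by the first term and, [sigma]
    being injective, leaves the other selected coefficients unchanged; induction then applies to the
    remainder. An arbitrary injection [sigma] serves frequencies going to either infinity. *)
Lemma bessel (N : nat) : forall (f : R -> C) (sigma : nat -> Z),
  Ccont f -> (forall i j, sigma i = sigma j -> i = j) ->
  sum_f_R0 (fun n => Cmod (fourier f (sigma n)) ^ 2) N <= Rmean (fun t => Cmod (f t) ^ 2).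
Proof.
  assert (Hpos : forall f k, Ccont f ->
    Cmod (fourier f k) ^ 2 <= Rmean (fun t => Cmod (f t) ^ 2) /\
    Ccont (fun t => f t + - fourier f k * cis k t)%C).
  { intros f k Hf.
    assert (H : Ccont (fun t => f t + - fourier f k * cis k t)%C).
    { apply Ccont_plus; [exact Hf|].
      apply Ccont_mult; [apply Ccont_const|apply Ccont_cis]. }
    split; [|exact H].
    pose proof (Rmean_Cmod2_sub_fourier f k Hf) as E.
    assert (0 <= Rmean (fun t => Cmod (f t + - fourier f k * cis k t) ^ 2)).
    { rewrite <- (Rmean_const 0). apply Rmean_le; [intros; apply continuous_const| |].
      - apply Ccont_Cmod2, H.
      - intros t; apply pow2_ge_0. }
    lra. }
  induction N as [|N IH]; intros f sigma Hf Hs.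
  - apply Hpos, Hf.
  - rewrite decomp_sum by lia. simpl pred.
    destruct (Hpos f (sigma O) Hf) as [_ Hf'].
    specialize (IH (fun t => f t + - fourier f (sigma O) * cis (sigma O) t)%C
      (fun n => sigma (S n)) Hf').
    cbv beta in IH. rewrite (Rmean_Cmod2_sub_fourier f (sigma O)) in IH by exact Hf.
    rewrite (sum_eq _ (fun n => Cmod (fourier f (sigma (S n))) ^ 2)) in IH.
    + assert (H := IH ltac:(intros i j E; apply Hs in E; lia)). lra.
    + intros i _. f_equal. f_equal.
      rewrite fourier_plus; [|exact Hf|apply Ccont_mult; [apply Ccont_const|apply Ccont_cis]].
      rewrite fourier_scal by apply Ccont_cis. rewrite fourier_cis.
      destruct (Z.eq_dec (sigma O) (sigma (S i))) as [E|_]; [apply Hs in E; lia|]. ring.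
Qed.

(** The one-term case of Bessel's inequality, in the role of the triangle inequality for complex
    integrals. *)
Lemma Cmod_fourier_le (f : R -> C) (k : Z) (M : R) :
  Ccont f -> (forall t, Cmod (f t) <= M) -> Cmod (fourier f k) <= M.
Proof.
  intros Hf HM. assert (0 <= M) by (eapply Rle_trans; [apply Cmod_ge_0|apply (HM 0)]).
  apply Rsqr_incr_0; [|apply Cmod_ge_0|assumption].
  rewrite !Rsqr_pow2.
  assert (Hb : Cmod (fourier f k) ^ 2 <= Rmean (fun t => Cmod (f t) ^ 2)).
  (* The shift by [n] only makes the family injective; the sum consists of the term at [k]. *)
  { pose proof (bessel 0 f (fun n => (k + Z.of_nat n)%Z) Hf ltac:(cbv beta; intros; lia)) as H1.
    simpl sum_f_R0 in H1. rewrite Z.add_0_r in H1. exact H1. }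
  eapply Rle_trans; [exact Hb|]. rewrite <- (Rmean_const (M ^ 2)).
  apply Rmean_le; [apply Ccont_Cmod2, Hf|intros; apply continuous_const|].
  intros t. apply pow_incr. split; [apply Cmod_ge_0|apply HM].
Qed.

Lemma ex_series_bounded_nonneg (u : nat -> R) (M : R) :
  (forall n, 0 <= u n) -> (forall N, sum_f_R0 u N <= M) -> ex_series u.
Proof.
  intros Hu HM.
  destruct (ex_finite_lim_seq_incr (sum_n u) M) as [l Hl].
  - intros n. rewrite sum_Sn. unfold plus; simpl. specialize (Hu (S n)); lra.
  - intros n. rewrite sum_n_Reals. apply HM.
  - exists l. exact Hl.
Qed.

(** The Riemann-Lebesgue lemma along an injective enumeration: these are the terms of a series that
    Bessel's inequality makes convergent. *)
Lemma fourier_small (f : R -> C) (sigma : nat -> Z) :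
  Ccont f -> (forall i j, sigma i = sigma j -> i = j) ->
  forall eps, 0 < eps -> exists N, forall n, (N <= n)%nat -> Cmod (fourier f (sigma n)) < eps.
Proof.
  intros Hf Hs eps Heps.
  assert (Hex : ex_series (fun n => Cmod (fourier f (sigma n)) ^ 2)).
  { apply (ex_series_bounded_nonneg _ (Rmean (fun t => Cmod (f t) ^ 2))).
    - intros; apply pow2_ge_0.
    - intros N; apply bessel; assumption. }
  apply ex_series_lim_0 in Hex. apply is_lim_seq_spec in Hex.
  destruct (Hex (mkposreal (eps ^ 2) ltac:(apply pow_lt; exact Heps))) as [N HN].
  exists N. intros n Hn. specialize (HN n Hn). simpl pos in HN.
  rewrite Rminus_0_r, Rabs_right in HN by (apply Rle_ge, pow2_ge_0).
  apply Rsqr_incrst_0; [rewrite !Rsqr_pow2; exact HN|apply Cmod_ge_0|lra].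
Qed.

(** * Taylor expansion of bounded holomorphic functions *)

Definition Ccts (f : C -> C) (z : C) : Prop :=
  forall eps, 0 < eps -> exists del, 0 < del /\
    forall w, Cmod (w - z) < del -> Cmod (f w - f z) < eps.

Lemma Cderiv_Ccts (f : C -> C) (z l : C) : Cderiv f z l -> Ccts f z.
Proof.
  intros H eps Heps. destruct (Cderiv_lipschitz f z l H) as [del [Hdel Hd]].
  pose proof (Cmod_ge_0 l).
  exists (Rmin del (eps / (Cmod l + 1))). split.
  { apply Rmin_pos; [exact Hdel|apply Rdiv_lt_0_compat; lra]. }
  intros w Hw. apply Rmin_Rgt_l in Hw. destruct Hw as [Hw1 Hw2].
  eapply Rle_lt_trans; [apply Hd, Hw1|].
  replace eps with ((Cmod l + 1) * (eps / (Cmod l + 1))) by (field; lra).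
  apply Rmult_lt_compat_l; lra.
Qed.

Lemma Ccts_comp (f g : C -> C) (z : C) :
  Ccts f z -> Ccts g (f z) -> Ccts (fun w => g (f w)) z.
Proof.
  intros Hf Hg eps Heps. destruct (Hg eps Heps) as [d1 [Hd1 G]].
  destruct (Hf d1 Hd1) as [d2 [Hd2 F]].
  exists d2; split; [exact Hd2|]. intros w Hw. apply G, F, Hw.
Qed.

Lemma Ccts_Ccont (G : C -> C) (s : R) :
  (forall t, Ccts G (s, t)) -> Ccont (fun t => G (s, t)).
Proof.
  intros H t.
  assert (K : forall eps, 0 < eps -> exists del, 0 < del /\
    forall t', Rabs (t' - t) < del -> Cmod (G (s, t') - G (s, t)) < eps).
  { intros eps Heps. destruct (H t eps Heps) as [del [Hdel Hd]].
    exists del; split; [exact Hdel|]. intros t' Ht'. apply Hd.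
    eapply Rle_lt_trans; [apply Cmod_le_Rabs|]. simpl.
    replace (s + - s) with 0 by ring. rewrite Rabs_R0, Rplus_0_l. exact Ht'. }
  split; apply continuity_pt_filterlim; intros eps Heps;
    destruct (K eps Heps) as [del [Hdel Hd]]; exists del; (split; [exact Hdel|]);
    intros t' [_ Ht']; specialize (Hd t' Ht'); (eapply Rle_lt_trans; [|exact Hd]).
  - apply (re_le_Cmod (G (s, t') - G (s, t))%C).
  - apply (Rabs_snd_le_Cmod (G (s, t') - G (s, t))%C).
Qed.

(** The value [l], meant as the derivative at [z0], fills the singularity continuously, so that the
    quotient has Fourier coefficients on the circle through [z0] itself. *)
Definition diff_quot (f : C -> C) (z0 l z : C) : C :=
  if Ceq_dec z z0 then l else ((f z - f z0) / (z - z0))%C.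

Lemma diff_quot_spec (f : C -> C) (z0 l z : C) :
  f z = (f z0 + (z - z0) * diff_quot f z0 l z)%C.
Proof.
  unfold diff_quot. destruct (Ceq_dec z z0) as [->|Hz]; [ring|].
  field. apply Cminus_eq_contra, Hz.
Qed.

Lemma diff_quot_Ccts (f : C -> C) (z0 l z : C) :
  Cderiv f z0 l -> Ccts f z -> Ccts (diff_quot f z0 l) z.
Proof.
  intros Hl Hf eps Heps. unfold diff_quot at 2. destruct (Ceq_dec z z0) as [->|Hz].
  - destruct (Hl (eps / 2) ltac:(lra)) as [del [Hdel Hd]].
    exists del; split; [exact Hdel|]. intros w Hw. unfold diff_quot.
    destruct (Ceq_dec w z0) as [->|Hw0].
    { replace (l - l)%C with (RtoC 0) by ring. rewrite Cmod_0. exact Heps. }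
    specialize (Hd w Hw). assert (Hne := Cminus_eq_contra _ _ Hw0).
    assert (Hp : 0 < Cmod (w - z0)) by (apply Cmod_gt_0, Hne).
    replace ((f w - f z0) / (w - z0) - l)%C with
      ((f w - f z0 - l * (w - z0)) / (w - z0))%C by (field; exact Hne).
    rewrite Cmod_div by exact Hne.
    apply Rle_lt_trans with (eps / 2); [|lra].
    apply (Rmult_le_reg_r (Cmod (w - z0))); [exact Hp|].
    unfold Rdiv at 1. rewrite Rmult_assoc, Rinv_l by lra. lra.
  - assert (Hne := Cminus_eq_contra _ _ Hz).
    set (D := Cmod (z - z0)). assert (HD : 0 < D) by (apply Cmod_gt_0, Hne).
    set (A := Cmod ((f z - f z0) / (z - z0))). assert (HA : 0 <= A) by apply Cmod_ge_0.
    destruct (Hf (D / 2 * (eps / 2))) as [d1 [Hd1 F]].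
    { apply Rmult_lt_0_compat; lra. }
    (* [D / 2] keeps the denominator [w - z0] larger than [D / 2] in modulus; the other two radii
       make each part of the numerator at most [D / 2 * (eps / 2)]. *)
    exists (Rmin d1 (Rmin (D / 2) (D / 2 * (eps / (2 * (A + 1)))))). split.
    { repeat apply Rmin_pos; [exact Hd1|lra|].
      apply Rmult_lt_0_compat; [lra|apply Rdiv_lt_0_compat; lra]. }
    intros w Hw. apply Rmin_Rgt_l in Hw. destruct Hw as [Hw1 Hw2].
    apply Rmin_Rgt_l in Hw2. destruct Hw2 as [Hw2 Hw3].
    assert (HwD : D / 2 < Cmod (w - z0)).
    { assert (Ht : D <= Cmod (z - w) + Cmod (w - z0)).
      { unfold D. replace (z - z0)%C with ((z - w) + (w - z0))%C by ring. apply Cmod_triangle. }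
      replace (z - w)%C with (- (w - z))%C in Ht by ring. rewrite Cmod_opp in Ht. lra. }
    assert (Hw0 : (w - z0)%C <> 0) by (apply Cmod_gt_0; lra).
    unfold diff_quot. destruct (Ceq_dec w z0) as [E|_].
    { exfalso. apply Hw0. rewrite E. ring. }
    replace ((f w - f z0) / (w - z0) - (f z - f z0) / (z - z0))%C with
      (((f w - f z) + - ((f z - f z0) / (z - z0) * (w - z))) / (w - z0))%C
      by (field; split; assumption).
    rewrite Cmod_div by exact Hw0.
    apply (Rmult_lt_reg_r (Cmod (w - z0))); [lra|].
    unfold Rdiv at 1. rewrite Rmult_assoc, Rinv_l, Rmult_1_r by lra.
    eapply Rle_lt_trans; [apply Cmod_triangle|].
    rewrite Cmod_opp, Cmod_mult. fold A.
    specialize (F w Hw1).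
    assert (A * Cmod (w - z) <= D / 2 * (eps / 2)).
    { apply Rle_trans with ((A + 1) * (D / 2 * (eps / (2 * (A + 1))))).
      - apply Rmult_le_compat; [exact HA|apply Cmod_ge_0|lra|lra].
      - apply Req_le. field. lra. }
    assert (eps * (D / 2) < eps * Cmod (w - z0)) by (apply Rmult_lt_compat_l; lra).
    lra.
Qed.

(** * Circles in the coordinate log z *)

Lemma Cexp_scal (k : Z) (s t : R) :
  Cexp (RtoC (IZR k) * (s, t)) = (RtoC (exp (IZR k * s)) * cis k t)%C.
Proof.
  unfold Cexp, cis, RtoC, Cmult; simpl.
  replace (IZR k * s - 0 * t) with (IZR k * s) by ring.
  replace (IZR k * t + 0 * s) with (IZR k * t) by ring.
  f_equal; ring.
Qed.

Lemma Cexp_polar (s t : R) : Cexp (s, t) = (RtoC (exp s) * cis 1 t)%C.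
Proof.
  rewrite <- (Rmult_1_l s) at 2. rewrite <- (Cexp_scal 1). f_equal.
  symmetry. exact (Cmult_1_l (s, t)).
Qed.

Lemma Cexp_pow (s t : R) (n : nat) :
  Cpow (Cexp (s, t)) n = (RtoC (exp (IZR (Z.of_nat n) * s)) * cis (Z.of_nat n) t)%C.
Proof.
  induction n as [|n IH].
  - simpl Z.of_nat. rewrite cis_0, Rmult_0_l, exp_0. simpl. ring.
  - rewrite Cpow_S, IH, Cexp_polar, Nat2Z.inj_succ.
    replace (Z.succ (Z.of_nat n)) with (1 + Z.of_nat n)%Z by lia.
    rewrite cis_plus, plus_IZR, Rmult_plus_distr_r, exp_plus, RtoC_mult, Rmult_1_l. ring.
Qed.

(** The argument is plus or minus the arc cosine of Re z / |z|, the sign being that of the imaginary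
    part. *)
Lemma polar_form (z : C) : z <> 0 -> exists t, z = Cexp (ln (Cmod z), t).
Proof.
  intros Hz. apply Cmod_gt_0 in Hz. destruct z as [x y].
  set (r := Cmod (x, y)) in *. unfold Cexp; simpl. rewrite exp_ln by exact Hz.
  assert (Hr : r ^ 2 = x ^ 2 + y ^ 2) by (unfold r; rewrite Cmod2_alt; reflexivity).
  set (u := x / r).
  assert (Hu2 : 1 - Rsqr u = Rsqr (y / r)).
  { unfold u, Rsqr. apply (Rmult_eq_reg_r (r ^ 2)); [|nra]. field_simplify; [|lra|lra]. lra. }
  assert (Hu : -1 <= u <= 1).
  { assert (Rsqr u <= 1) by (pose proof (Rle_0_sqr (y / r)); lra).
    unfold Rsqr in H. split; nra. }
  assert (Hs : sin (acos u) = Rabs (y / r)).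
  { rewrite sin_acos by exact Hu. rewrite Hu2. apply sqrt_Rsqr_abs. }
  assert (Hx : x = r * u) by (unfold u; field; lra).
  destruct (Rle_lt_dec 0 (y / r)) as [Hy|Hy].
  - exists (acos u). rewrite cos_acos, Hs by exact Hu. rewrite Rabs_right by lra.
    f_equal; [exact Hx|field; lra].
  - exists (- acos u). rewrite cos_neg, sin_neg, cos_acos, Hs by exact Hu.
    rewrite Rabs_left by lra. f_equal; [exact Hx|field; lra].
Qed.

Lemma in_disc_Cexp (w : C) : fst w < 0 -> in_disc (Cexp w).
Proof.
  intros H. unfold in_disc. rewrite Cmod_Cexp, <- exp_0. apply exp_increasing, H.
Qed.

Definition holo_disc (f : C -> C) : Prop := forall z, in_disc z -> exists l, Cderiv f z l.

Lemma Ccont_circle (f : C -> C) (s : R) :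
  holo_disc f -> s < 0 -> Ccont (fun t => f (Cexp (s, t))).
Proof.
  intros Hf Hs. apply (Ccts_Ccont (fun w => f (Cexp w))). intros t.
  apply (Ccts_comp Cexp f).
  - eapply Cderiv_Ccts, Cderiv_Cexp.
  - destruct (Hf (Cexp (s, t)) (in_disc_Cexp (s, _) Hs)) as [l Hl].
    eapply Cderiv_Ccts, Hl.
Qed.

(* Cauchy's theorem for [f(z) / z^k] on concentric circles, in the coordinate [w = log z],
   where the circles become periods of a half-plane. *)
Lemma fourier_circle_indep (f : C -> C) (k : Z) (s1 s2 : R) :
  holo_disc f -> s1 < 0 -> s2 < 0 ->
  (RtoC (exp (- IZR k * s1)) * fourier (fun t => f (Cexp (s1, t))) k)%C =
  (RtoC (exp (- IZR k * s2)) * fourier (fun t => f (Cexp (s2, t))) k)%C.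
Proof.
  intros Hf.
  set (F := fun w => (f (Cexp w) * Cexp (RtoC (IZR (- k)) * w))%C).
  assert (HF : forall w, fst w < 0 -> exists l, Cderiv F w l).
  { intros w Hw. destruct (Hf (Cexp w) (in_disc_Cexp w Hw)) as [l Hl].
    eexists. apply Cderiv_mult.
    - eapply Cderiv_comp; [apply Cderiv_Cexp|exact Hl].
    - apply (Cderiv_comp (fun w => RtoC (IZR (- k)) * w)%C Cexp);
        [apply Cderiv_scal_id|apply Cderiv_Cexp]. }
  (* Here it matters that [k] is an integer: e^(-k w) has period 2 pi i. *)
  assert (Hper : forall s t, F (s, t + 2 * PI) = F (s, t)).
  { intros s t. unfold F. rewrite !Cexp_scal, !Cexp_polar, !cis_period. reflexivity. }
  assert (E : forall s, s < 0 ->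
    (RtoC (exp (- IZR k * s)) * fourier (fun t => f (Cexp (s, t))) k)%C =
    Cmean (fun t => F (s, t))).
  { intros s Hs. unfold fourier. rewrite <- Cmean_scal.
    2: { apply Ccont_mult; [apply Ccont_circle; assumption|apply Ccont_cis]. }
    apply Cmean_ext. intros t. unfold F. rewrite Cexp_scal, opp_IZR. ring. }
  assert (M : forall s s', s < s' -> s' < 0 ->
    Cmean (fun t => F (s, t)) = Cmean (fun t => F (s', t))).
  { intros s s' H1 H2. unfold Cmean, Rmean. f_equal; f_equal.
    - apply RInt_Re_periodic_strip; assumption.
    (* The strip lemma concerns real parts; Im F = Re (-i F) reduces the imaginary part to it. *)
    - assert (EI : forall u, RInt (fun t => Im (F (u, t))) 0 (2 * PI) =
        RInt (fun t => Re ((fun w => - Ci * F w)%C (u, t))) 0 (2 * PI)).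
      { intros u. apply RInt_ext. intros t _. unfold Re, Im; simpl. ring. }
      rewrite !EI. apply (RInt_Re_periodic_strip (fun w => - Ci * F w)%C); try assumption.
      + intros w Hw. destruct (HF w Hw) as [l Hl]. eexists.
        apply (Cderiv_mult (fun _ => - Ci)%C); [apply Cderiv_const|exact Hl].
      + intros u t. rewrite Hper. reflexivity. }
  intros H1 H2. rewrite !E by assumption.
  destruct (Rtotal_order s1 s2) as [H|[->|H]]; [|reflexivity|symmetry]; apply M; assumption.
Qed.

(** The coefficient read off on the circle of radius 1/e, an arbitrary choice; [exp (IZR k)] is
    r^(-k) there. Integer indices allow the Laurent coefficients with [k < 0] to be shown to
    vanish. *)
Definition taylor_coef (f : C -> C) (k : Z) : C :=
  (RtoC (exp (IZR k)) * fourier (fun t => f (Cexp (-1, t))) k)%C.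

Lemma fourier_circle (f : C -> C) (k : Z) (s : R) :
  holo_disc f -> s < 0 ->
  fourier (fun t => f (Cexp (s, t))) k = (RtoC (exp (IZR k * s)) * taylor_coef f k)%C.
Proof.
  intros Hf Hs. unfold taylor_coef.
  pose proof (fourier_circle_indep f k (-1) s Hf ltac:(lra) Hs) as E.
  replace (- IZR k * -1) with (IZR k) in E by ring. rewrite E.
  rewrite Cmult_assoc, <- RtoC_mult, <- exp_plus.
  replace (IZR k * s + - IZR k * s) with 0 by ring. rewrite exp_0. ring.
Qed.

(** Cauchy's estimate on the circle of radius r = e^s, with [exp (IZR k * s)] as r^k. It is applied
    to small radii. *)
Lemma taylor_coef_estimate (f : C -> C) (k : Z) (s K : R) :
  holo_disc f -> s < 0 -> (forall t, Cmod (f (Cexp (s, t))) <= K) ->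
  Cmod (taylor_coef f k) * exp (IZR k * s) <= K.
Proof.
  intros Hf Hs HK.
  assert (E := fourier_circle f k s Hf Hs).
  apply (f_equal Cmod) in E. rewrite Cmod_mult, Cmod_R, Rabs_right in E
    by (apply Rle_ge, Rlt_le, exp_pos).
  rewrite Rmult_comm, <- E. apply Cmod_fourier_le; [|exact HK].
  apply Ccont_circle; assumption.
Qed.

Lemma taylor_coef_neg (f : C -> C) (M : R) (k : Z) :
  holo_disc f -> (forall z, in_disc z -> Cmod (f z) <= M) -> (k < 0)%Z ->
  taylor_coef f k = 0.
Proof.
  intros Hf HM Hk. destruct (Ceq_dec (taylor_coef f k) 0) as [|Hne]; [assumption|exfalso].
  apply Cmod_gt_0 in Hne. set (B := Cmod (taylor_coef f k)) in *.
  assert (HM0 : 0 <= M).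
  { eapply Rle_trans; [apply Cmod_ge_0|apply (HM 0)]. unfold in_disc. rewrite Cmod_0. lra. }
  (* A radius: for [k < 0] Cauchy's estimate gives [B <= M * e], while this choice makes [M * e] at
     most [B / 2]. The [+ 1] keeps the denominator positive when [M = 0]. *)
  set (e := Rmin (1 / 2) (B / (2 * (M + 1)))).
  assert (He : 0 < e) by (apply Rmin_pos; [lra|apply Rdiv_lt_0_compat; lra]).
  assert (He1 : e <= 1 / 2) by apply Rmin_l.
  assert (He2 : e * (M + 1) <= B / 2).
  { replace (B / 2) with (B / (2 * (M + 1)) * (M + 1)) by (field; lra).
    apply Rmult_le_compat_r; [lra|apply Rmin_r]. }
  assert (Hs : ln e < 0) by (rewrite <- ln_1; apply ln_increasing; lra).
  pose proof (taylor_coef_estimate f k (ln e) M Hf Hs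
    ltac:(intros t; apply HM, in_disc_Cexp, Hs)) as H. fold B in H.
  assert (Hexp : / e <= exp (IZR k * ln e)).
  { rewrite <- (exp_ln e) at 1 by exact He. rewrite <- exp_Ropp.
    assert (- ln e <= IZR k * ln e).
    { assert (IZR k <= -1) by (apply IZR_le; lia). nra. }
    destruct (Rle_lt_or_eq_dec _ _ H0) as [Hlt| ->];
      [apply Rlt_le, exp_increasing, Hlt|apply Rle_refl]. }
  assert (B * / e <= M) by (eapply Rle_trans; [apply Rmult_le_compat_l; [lra|exact Hexp]|exact H]).
  assert (B <= M * e).
  { apply (Rmult_le_compat_r e) in H0; [|lra].
    rewrite Rmult_assoc, Rinv_l, Rmult_1_r in H0 by lra. exact H0. }
  nra.
Qed.

Lemma taylor_coef_in_H2 (f : C -> C) (M : R) :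
  holo_disc f -> (forall z, in_disc z -> Cmod (f z) <= M) ->
  in_H2 (fun n => taylor_coef f (Z.of_nat n)).
Proof.
  intros Hf HM. apply (ex_series_bounded_nonneg _ (exp 1 * M ^ 2)).
  { intros n; apply pow2_ge_0. }
  intros N.
  (* The radius is taken so close to 1 that [r^(-2n) <= e] for all [n <= N]. *)
  set (s := - / (2 * (INR N + 1))).
  assert (HN : 0 <= INR N) by apply pos_INR.
  assert (Hs : s < 0).
  { unfold s. assert (0 < / (2 * (INR N + 1))) by (apply Rinv_0_lt_compat; lra). lra. }
  set (h := fun t => f (Cexp (s, t))).
  assert (Hh : Ccont h) by (apply Ccont_circle; assumption).
  apply Rle_trans with (sum_f_R0 (fun n => Cmod (fourier h (Z.of_nat n)) ^ 2 * exp 1) N).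
  - apply sum_Rle. intros n Hn.
    unfold h. rewrite fourier_circle by assumption.
    rewrite Cmod_mult, Cmod_R, Rabs_right by (apply Rle_ge, Rlt_le, exp_pos).
    rewrite Rpow_mult_distr.
    assert (Hpow : 1 <= exp (IZR (Z.of_nat n) * s) ^ 2 * exp 1).
    { replace (exp (IZR (Z.of_nat n) * s) ^ 2) with
        (exp (IZR (Z.of_nat n) * s + IZR (Z.of_nat n) * s)) by (rewrite exp_plus; ring).
      rewrite <- exp_plus. rewrite <- INR_IZR_INZ.
      assert (0 <= INR n * s + INR n * s + 1).
      { assert (INR n <= INR N) by (apply le_INR; exact Hn).
        assert (2 * (INR N + 1) * s = -1) by (unfold s; field; lra). nra. }
      destruct (Rle_lt_or_eq_dec _ _ H) as [Hlt| <-].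
      - rewrite <- exp_0 at 1. apply Rlt_le, exp_increasing, Hlt.
      - rewrite exp_0. lra. }
    pose proof (pow2_ge_0 (Cmod (taylor_coef f (Z.of_nat n)))). nra.
  - rewrite <- scal_sum. apply Rmult_le_compat_l; [apply Rlt_le, exp_pos|].
    eapply Rle_trans; [apply bessel; [exact Hh|intros; lia]|].
    rewrite <- (Rmean_const (M ^ 2)).
    apply Rmean_le; [apply Ccont_Cmod2, Hh|intros; apply continuous_const|].
    intros t. apply pow_incr. split; [apply Cmod_ge_0|]. apply HM, in_disc_Cexp, Hs.
Qed.

Lemma is_series_C_eps (u : nat -> C) (l : C) :
  (forall eps, 0 < eps -> exists N, forall n, (N <= n)%nat ->
     Cmod (@sum_n C_AbelianMonoid u n - l) < eps) ->
  @is_series C_AbsRing C_NormedModule u l.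
Proof.
  intros H. apply (filterlim_locally (U := C_UniformSpace)). intros eps.
  destruct (H eps (cond_pos eps)) as [N HN]. exists N. intros n Hn.
  apply C_NormedModule_mixin_compat1. apply HN, Hn.
Qed.

(** The remainder is exact, and [g] depends on the point but not on [N]: convergence at this point
    becomes decay of the Fourier coefficients of one continuous function. *)
Lemma taylor_partial_sum (f : C -> C) (M s t0 : R) :
  holo_disc f -> (forall z, in_disc z -> Cmod (f z) <= M) -> s < 0 ->
  exists g : R -> C, Ccont g /\ forall N,
    (@sum_n C_AbelianMonoid
       (fun n => taylor_coef f (Z.of_nat n) * Cpow (Cexp (s, t0)) n)%C N - f (Cexp (s, t0)))%C =
    (- (RtoC (exp s) * fourier g (Z.of_nat N) * cis (Z.of_nat N + 1) t0))%C.
Proof.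
  intros Hf HM Hs. set (z0 := Cexp (s, t0)).
  destruct (Hf z0 (in_disc_Cexp (s, _) Hs)) as [l Hl].
  set (h := fun t => f (Cexp (s, t))).
  set (g := fun t => diff_quot f z0 l (Cexp (s, t))).
  assert (Hh : Ccont h) by (apply Ccont_circle; assumption).
  assert (Hg : Ccont g).
  { apply (Ccts_Ccont (fun w => diff_quot f z0 l (Cexp w))). intros t.
    apply (Ccts_comp Cexp (diff_quot f z0 l)).
    - eapply Cderiv_Ccts, Cderiv_Cexp.
    - apply diff_quot_Ccts; [exact Hl|].
      destruct (Hf (Cexp (s, t)) (in_disc_Cexp (s, _) Hs)) as [l' Hl'].
      eapply Cderiv_Ccts, Hl'. }
  (* This is z0 times the k-th Fourier coefficient of [g], rotated by [cis k t0]; with this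
     normalisation the recursion below is a pure difference. *)
  set (gam := fun k => (RtoC (exp s) * fourier g k * cis (k + 1) t0)%C).
  assert (Hz0 : z0 = (RtoC (exp s) * cis 1 t0)%C) by apply Cexp_polar.
  (* Comparing Fourier coefficients in [f(z) = f(z0) + (z - z0) g]. *)
  assert (Hrec : forall k, (fourier h k * cis k t0)%C =
    ((if Z.eq_dec 0 k then f z0 else 0) + gam (k - 1)%Z - gam k)%C).
  { intros k.
    assert (E : fourier h k = (f z0 * (if Z.eq_dec 0 k then 1 else 0) +
      (RtoC (exp s) * fourier g (k - 1) + - z0 * fourier g k))%C).
    { rewrite <- (fourier_cis 0 k).
      rewrite <- (fourier_mult_cis g 1 k).
      assert (C1 : Ccont (fun t => cis 1 t * g t)%C)
        by (apply Ccont_mult; [apply Ccont_cis|exact Hg]).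
      rewrite <- !fourier_scal by (exact C1 || exact Hg || apply Ccont_cis).
      rewrite <- !fourier_plus;
        try (repeat apply Ccont_plus; apply Ccont_mult;
             (apply Ccont_const || apply Ccont_cis || exact C1 || exact Hg)).
      unfold fourier. apply Cmean_ext. intros t. unfold h.
      rewrite (diff_quot_spec f z0 l (Cexp (s, t))). fold (g t).
      rewrite cis_0, (Cexp_polar s t). ring. }
    rewrite E. unfold gam.
    replace (k - 1 + 1)%Z with k by lia. rewrite cis_plus, Hz0.
    destruct (Z.eq_dec 0 k) as [<-|_]; [rewrite cis_0; ring|ring]. }
  assert (Hneg : forall k, (k < 0)%Z -> gam (k - 1)%Z = gam k).
  { intros k Hk. specialize (Hrec k). unfold h in Hrec.
    rewrite fourier_circle, (taylor_coef_neg f M) in Hrec by assumption.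
    destruct (Z.eq_dec 0 k); [lia|].
    apply Ceq_minus. transitivity (0 + gam (k - 1)%Z - gam k)%C; [ring|].
    rewrite <- Hrec. ring. }
  assert (Hgam : forall n, gam (-1)%Z = gam (-1 - Z.of_nat n)%Z).
  { induction n as [|n IH]; [reflexivity|]. rewrite IH.
    replace (-1 - Z.of_nat (S n))%Z with (-1 - Z.of_nat n - 1)%Z by lia.
    symmetry. apply Hneg. lia. }
  (* This is the lower end of the telescoping sum. For [k < 0] the coefficients of [f] vanish, so
     [gam] is constant on the indices up to -1, and [fourier_small] towards minus infinity forces
     the constant to be 0. *)
  assert (H0 : gam (-1)%Z = 0).
  { destruct (Ceq_dec (gam (-1)%Z) 0) as [|Hne]; [assumption|exfalso].
    apply Cmod_gt_0 in Hne.
    destruct (fourier_small g (fun n => (-1 - Z.of_nat n)%Z) Hg ltac:(cbv beta; intros; lia)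
      (Cmod (gam (-1)%Z)) Hne) as [N HN].
    specialize (HN N (le_n N)). rewrite (Hgam N) in HN. unfold gam in HN.
    rewrite !Cmod_mult, Cmod_cis, Cmod_R, Rabs_right in HN by (apply Rle_ge, Rlt_le, exp_pos).
    assert (exp s < 1) by (rewrite <- exp_0; apply exp_increasing, Hs).
    pose proof (Cmod_ge_0 (fourier g (-1 - Z.of_nat N))). nra. }
  exists g. split; [exact Hg|]. intros N. fold (gam (Z.of_nat N)).
  assert (Hterm : forall n, (taylor_coef f (Z.of_nat n) * Cpow z0 n)%C =
    (fourier h (Z.of_nat n) * cis (Z.of_nat n) t0)%C).
  { intros n. unfold h, z0. rewrite fourier_circle, Cexp_pow by assumption. ring. }
  induction N as [|N IH].
  - rewrite sum_O, Hterm, Hrec. simpl Z.of_nat. simpl (0 - 1)%Z. rewrite H0.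
    destruct (Z.eq_dec 0 0); [ring|lia].
  - rewrite sum_Sn. change (@plus C_AbelianMonoid) with Cplus.
    rewrite Hterm, Hrec. destruct (Z.eq_dec 0 (Z.of_nat (S N))); [lia|].
    replace (Z.of_nat (S N) - 1)%Z with (Z.of_nat N) by lia.
    transitivity ((@sum_n C_AbelianMonoid
       (fun n => taylor_coef f (Z.of_nat n) * Cpow z0 n)%C N - f z0) +
       (gam (Z.of_nat N) - gam (Z.of_nat (S N))))%C; [ring|].
    rewrite IH. ring.
Qed.

(** The difference of the two sides is the 0-th Fourier coefficient of [f - f 0] on every small
    circle, and continuity at 0 makes it arbitrarily small. *)
Lemma taylor_coef_0 (f : C -> C) : holo_disc f -> taylor_coef f 0 = f 0.
Proof.
  intros Hf. destruct (Ceq_dec (taylor_coef f 0) (f 0)) as [|Hne]; [assumption|exfalso].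
  apply Cminus_eq_contra in Hne. apply Cmod_gt_0 in Hne.
  set (e := Cmod (taylor_coef f 0 - f 0)) in *.
  destruct (Hf 0) as [l Hl]; [unfold in_disc; rewrite Cmod_0; lra|].
  destruct (Cderiv_Ccts _ _ _ Hl (e / 2) ltac:(lra)) as [del [Hdel Hd]].
  set (r := Rmin (1 / 2) (del / 2)).
  assert (Hr : 0 < r) by (apply Rmin_pos; lra).
  assert (Hr1 : r <= 1 / 2) by apply Rmin_l.
  assert (Hr2 : r <= del / 2) by apply Rmin_r.
  assert (Hs : ln r < 0) by (rewrite <- ln_1; apply ln_increasing; lra).
  assert (Hh := Ccont_circle f (ln r) Hf Hs).
  assert (HC : Ccont (fun t => - f 0 * cis 0 t)%C)
    by (apply Ccont_mult; [apply Ccont_const|apply Ccont_cis]).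
  assert (E : (taylor_coef f 0 - f 0)%C =
    fourier (fun t => f (Cexp (ln r, t)) + - f 0 * cis 0 t)%C 0).
  { rewrite fourier_plus, fourier_scal, fourier_cis, fourier_circle by
      (assumption || apply Ccont_cis).
    rewrite Rmult_0_l, exp_0. destruct (Z.eq_dec 0 0); [ring|lia]. }
  assert (Hle : e <= e / 2).
  { unfold e at 1. rewrite E. apply Cmod_fourier_le; [apply Ccont_plus; assumption|].
    intros t. rewrite cis_0, Cmult_1_r. apply Rlt_le, Hd.
    replace (Cexp (ln r, t) - 0)%C with (Cexp (ln r, t)) by ring.
    rewrite Cmod_Cexp. simpl. rewrite exp_ln by exact Hr. lra. }
  lra.
Qed.

Lemma taylor_expansion (f : C -> C) (M : R) (z : C) :
  holo_disc f -> (forall z, in_disc z -> Cmod (f z) <= M) -> in_disc z ->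
  h2_eval_is (fun n => taylor_coef f (Z.of_nat n)) z (f z).
Proof.
  intros Hf HM Hz. apply is_series_C_eps. intros eps Heps.
  (* The centre has no logarithm; there every partial sum already equals [f 0]. *)
  destruct (Ceq_dec z 0) as [->|Hne].
  - exists O. intros n _.
    replace (@sum_n C_AbelianMonoid
      (fun n => taylor_coef f (Z.of_nat n) * Cpow 0 n)%C n) with (f 0).
    { replace (f 0 - f 0)%C with (RtoC 0) by ring. rewrite Cmod_0. exact Heps. }
    induction n as [|n IH].
    + rewrite sum_O. simpl. rewrite taylor_coef_0 by exact Hf. ring.
    + rewrite sum_Sn, <- IH, Cpow_S. change (@plus C_AbelianMonoid) with Cplus. ring.
  - destruct (polar_form z Hne) as [t0 Ht0].
    apply Cmod_gt_0 in Hne. unfold in_disc in Hz.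
    assert (Hs : ln (Cmod z) < 0) by (rewrite <- ln_1; apply ln_increasing; lra).
    set (s := ln (Cmod z)) in *. rewrite Ht0.
    destruct (taylor_partial_sum f M s t0 Hf HM Hs) as [g [Hg E]].
    destruct (fourier_small g Z.of_nat Hg Nat2Z.inj eps Heps) as [N HN].
    exists N. intros n Hn. rewrite E, Cmod_opp, !Cmod_mult, Cmod_cis, Cmod_R, Rabs_right
      by (apply Rle_ge, Rlt_le, exp_pos).
    specialize (HN n Hn).
    assert (exp s < 1) by (rewrite <- exp_0; apply exp_increasing, Hs).
    pose proof (exp_pos s). pose proof (Cmod_ge_0 (fourier g (Z.of_nat n))). nra.
Qed.

(** * Adjoints of composition operators *)

Lemma is_series_single {K : AbsRing} {V : NormedModule K} (u : nat -> V) (m : nat) :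
  (forall n, n <> m -> u n = zero) -> is_series u (u m).
Proof.
  intros Hu.
  assert (H0 : forall n, (n < m)%nat -> sum_n u n = zero).
  { induction n as [|n IH]; intros Hn.
    - rewrite sum_O. apply Hu. lia.
    - rewrite sum_Sn, IH, Hu by lia. apply plus_zero_l. }
  assert (H1 : forall n, (m <= n)%nat -> sum_n u n = u m).
  { intros n Hn. induction Hn as [|n Hn IH].
    - destruct m as [|m]; [apply sum_O|].
      rewrite sum_Sn, H0 by lia. apply plus_zero_l.
    - rewrite sum_Sn, IH, (Hu (S n)) by lia. apply plus_zero_r. }
  apply (filterlim_ext_loc (fun _ => u m)).
  - exists m. intros n Hn. symmetry. apply H1, Hn.
  - apply filterlim_const.
Qed.

Lemma is_series_C_unique (u : nat -> C) (l l' : C) :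
  @is_series C_AbsRing C_NormedModule u l -> @is_series C_AbsRing C_NormedModule u l' -> l = l'.
Proof. apply (@filterlim_locally_unique nat C_AbsRing C_NormedModule eventually _). Qed.

Definition monomial (m n : nat) : C := if Nat.eq_dec n m then 1 else 0.

Lemma monomial_diag (m : nat) : monomial m m = 1.
Proof. unfold monomial. destruct (Nat.eq_dec m m); congruence. Qed.

Lemma monomial_off (m n : nat) : n <> m -> monomial m n = 0.
Proof. unfold monomial. destruct (Nat.eq_dec n m); congruence. Qed.

Lemma monomial_in_H2 (m : nat) : in_H2 (monomial m).
Proof.
  eexists. apply (is_series_single (V := R_NormedModule) _ m).
  intros n Hn. rewrite monomial_off, Cmod_0 by exact Hn. apply (pow_i 2). lia.
Qed.

Lemma monomial_eval (m : nat) (z : C) : h2_eval_is (monomial m) z (Cpow z m).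
Proof.
  replace (Cpow z m) with (monomial m m * Cpow z m)%C by (rewrite monomial_diag; ring).
  apply (is_series_single (V := C_NormedModule) (fun n => monomial m n * Cpow z n)%C).
  intros n Hn. rewrite monomial_off by exact Hn. apply Cmult_0_l.
Qed.

Lemma inner_monomial_r (c : nat -> C) (m : nat) : h2_inner_is c (monomial m) (c m).
Proof.
  replace (c m) with (c m * Cconj (monomial m m))%C at 1.
  - apply (is_series_single (V := C_NormedModule) (fun n => c n * Cconj (monomial m n))%C).
    intros n Hn. rewrite monomial_off by exact Hn.
    unfold Cconj, RtoC; simpl. rewrite Ropp_0. apply Cmult_0_r.
  - rewrite monomial_diag. unfold Cconj, RtoC; simpl. rewrite Ropp_0. apply Cmult_1_r.
Qed.

Lemma inner_monomial_l (d : nat -> C) (m : nat) : h2_inner_is (monomial m) d (Cconj (d m)).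
Proof.
  replace (Cconj (d m)) with (monomial m m * Cconj (d m))%C
    by (rewrite monomial_diag; apply Cmult_1_l).
  apply (is_series_single (V := C_NormedModule) (fun n => monomial m n * Cconj (d n))%C).
  intros n Hn. rewrite monomial_off by exact Hn. apply Cmult_0_l.
Qed.

(** * Composition operators on monomials *)

Lemma holo_self_map_pow (phi : C -> C) (n : nat) :
  holo_self_map phi ->
  holo_disc (fun z => Cpow (phi z) n) /\
  forall z, in_disc z -> Cmod (Cpow (phi z) n) <= 1.
Proof.
  intros [Hd Hs]. split.
  - intros z Hz. apply ex_Cderiv_pow. destruct (Hd z Hz) as [l Hl].
    exists l. apply Cderiv_is_derive, Hl.
  - intros z Hz. rewrite Cmod_pow, <- (pow1 n). apply pow_incr.
    split; [apply Cmod_ge_0|]. apply Rlt_le, Hs, Hz.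
Qed.

Definition pow_coef (phi : C -> C) (n j : nat) : C :=
  taylor_coef (fun z => Cpow (phi z) n) (Z.of_nat j).

Lemma comp_op_monomial (phi : C -> C) (n : nat) :
  holo_self_map phi -> comp_op_is phi (monomial n) (pow_coef phi n).
Proof.
  intros Hphi. destruct (holo_self_map_pow phi n Hphi) as [Hf HM]. split.
  - exact (taylor_coef_in_H2 _ 1 Hf HM).
  - intros z Hz. exists (Cpow (phi z) n). split; [apply monomial_eval|].
    exact (taylor_expansion _ 1 z Hf HM Hz).
Qed.

(** Constants are fixed by composition. Taking [monomial 0] as the image, and not [pow_coef phi 0],
    gives its coefficients explicitly. *)
Lemma comp_op_one (phi : C -> C) : comp_op_is phi (monomial 0) (monomial 0).
Proof.
  split; [apply monomial_in_H2|]. intros z _. exists 1.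
  split; [exact (monomial_eval 0 (phi z))|exact (monomial_eval 0 z)].
Qed.

(** Comparison of matrix entries in the monomial basis. [c] and [d] are left arbitrary so that
    either form of the image, [pow_coef] or [monomial 0], can be inserted. *)
Lemma adjoint_coefs (phi psi : C -> C) (m n : nat) (c d : nat -> C) :
  adjoint_is_comp phi psi ->
  comp_op_is phi (monomial m) c -> comp_op_is psi (monomial n) d -> c n = Cconj (d m).
Proof.
  intros Hadj Hc Hd.
  destruct (Hadj _ _ c d (monomial_in_H2 m) (monomial_in_H2 n) Hc Hd) as [l [H1 H2]].
  transitivity l.
  - eapply is_series_C_unique; [apply inner_monomial_r|exact H1].
  - eapply is_series_C_unique; [exact H2|apply inner_monomial_l].
Qed.

Lemma Cconj_eq_0 (z : C) : Cconj z = 0 -> z = 0.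
Proof.
  intros H. apply Cmod_eq_0. rewrite <- Cmod_conj, H. apply Cmod_0.
Qed.

(** Near 0, |psi z| <= K |z|; two factors of psi^n are bounded this way and the others by 1.
    Cauchy's estimate on radius r then bounds the coefficient by K^2 r, for every small r. *)
Lemma pow_coef_1_vanish (psi : C -> C) (n : nat) :
  holo_self_map psi -> psi 0 = 0 -> (2 <= n)%nat -> pow_coef psi n 1 = 0.
Proof.
  intros Hpsi H0 Hn. destruct (holo_self_map_pow psi n Hpsi) as [Hf _].
  destruct (Ceq_dec (pow_coef psi n 1) 0) as [|Hne]; [assumption|exfalso].
  apply Cmod_gt_0 in Hne. set (e := Cmod (pow_coef psi n 1)) in *.
  destruct Hpsi as [Hd Hs].
  destruct (Hd 0) as [l Hl]; [unfold in_disc; rewrite Cmod_0; lra|].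
  apply Cderiv_is_derive in Hl.
  destruct (Cderiv_lipschitz psi 0 l Hl) as [del [Hdel HL]].
  pose proof (Cmod_ge_0 l) as Hl0. set (K := Cmod l + 1) in *.
  assert (HK : 1 <= K) by (unfold K; lra).
  (* The three bounds keep the circle in the disc, keep it where the Lipschitz bound holds, and make
     K^2 r at most [e / 2], against [e <= r * K ^ 2]. *)
  set (r := Rmin (1 / 2) (Rmin (del / 2) (e / (2 * K ^ 2)))).
  assert (HK2 : 1 <= K ^ 2) by (simpl; nra).
  assert (Hr : 0 < r) by (repeat apply Rmin_pos; try lra; apply Rdiv_lt_0_compat; lra).
  assert (Hr1 : r <= 1 / 2) by apply Rmin_l.
  assert (Hr2 : r <= del / 2) by (eapply Rle_trans; [apply Rmin_r|apply Rmin_l]).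
  assert (Hr3 : r * K ^ 2 <= e / 2).
  { replace (e / 2) with (e / (2 * K ^ 2) * K ^ 2) by (field; lra).
    apply Rmult_le_compat_r; [lra|]. eapply Rle_trans; [apply Rmin_r|apply Rmin_r]. }
  clearbody r.
  assert (Hln : ln r < 0) by (rewrite <- ln_1; apply ln_increasing; lra).
  assert (H : e * exp (IZR 1 * ln r) <= (K * r) ^ 2).
  { apply (taylor_coef_estimate (fun z => Cpow (psi z) n) 1 (ln r)); [exact Hf|exact Hln|].
    intros t. set (z := Cexp (ln r, t)).
    assert (Hz : Cmod z = r) by (unfold z; rewrite Cmod_Cexp; simpl; apply exp_ln, Hr).
    assert (Hz1 : Cmod (psi z) < 1) by (apply Hs; unfold in_disc; lra).
    assert (Hz2 : Cmod (psi z) <= K * r).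
    { specialize (HL z). rewrite H0 in HL.
      replace (z - 0)%C with z in HL by ring. replace (psi z - 0)%C with (psi z) in HL by ring.
      rewrite Hz in HL. apply HL. lra. }
    rewrite Cmod_pow. pose proof (Cmod_ge_0 (psi z)) as Hp.
    replace n with (2 + (n - 2))%nat by lia. rewrite pow_add.
    rewrite <- (Rmult_1_r ((K * r) ^ 2)).
    apply Rmult_le_compat; try (apply pow_le, Hp).
    - apply pow_incr. split; [exact Hp|exact Hz2].
    - rewrite <- (pow1 (n - 2)). apply pow_incr. lra. }
  rewrite Rmult_1_l, exp_ln in H by exact Hr.
  assert (e <= r * K ^ 2).
  { apply (Rmult_le_reg_r r); [exact Hr|]. simpl in *. lra. }
  lra.
Qed.

Lemma adjoint_comp_linear (phi psi : C -> C) :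
  holo_self_map phi -> holo_self_map psi -> adjoint_is_comp phi psi ->
  exists delta : C, Cmod delta <= 1 /\ forall z, in_disc z -> phi z = (delta * z)%C.
Proof.
  intros Hphi Hpsi Hadj.
  set (c := pow_coef phi 1).
  assert (Hc : comp_op_is phi (monomial 1) c) by (apply comp_op_monomial, Hphi).
  assert (Hpsi0 : psi 0 = 0).
  { assert (E := adjoint_coefs phi psi 0 1 _ _ Hadj (comp_op_one phi)
      (comp_op_monomial psi 1 Hpsi)).
    rewrite monomial_off in E by lia. symmetry in E. apply Cconj_eq_0 in E.
    destruct (holo_self_map_pow psi 1 Hpsi) as [Hf _].
    unfold pow_coef in E. simpl Z.of_nat in E. rewrite taylor_coef_0 in E by exact Hf.
    rewrite Cpow_1_r in E. exact E. }
  assert (Hvan : forall n, n <> 1%nat -> c n = 0).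
  { intros n Hn. destruct n as [|n].
    - rewrite (adjoint_coefs phi psi 1 0 _ _ Hadj Hc (comp_op_one psi)).
      rewrite monomial_off by lia. unfold Cconj, RtoC; simpl. rewrite Ropp_0. reflexivity.
    - rewrite (adjoint_coefs phi psi 1 (S n) _ _ Hadj Hc (comp_op_monomial psi (S n) Hpsi)).
      rewrite pow_coef_1_vanish by (assumption || lia).
      unfold Cconj, RtoC; simpl. rewrite Ropp_0. reflexivity. }
  assert (Hlin : forall z, in_disc z -> phi z = (c 1%nat * z)%C).
  (* The common value [w] is computed twice: as the identity function at [phi z], and as the series
     of [c], whose only nonzero term can be the one of index 1. *)
  { intros z Hz. destruct (proj2 Hc z Hz) as [w [H1 H2]].
    transitivity w.
    - eapply is_series_C_unique; [|exact H1].
      pose proof (monomial_eval 1 (phi z)) as H. rewrite Cpow_1_r in H. exact H.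
    - eapply is_series_C_unique; [exact H2|].
      replace (c 1%nat * z)%C with (c 1%nat * Cpow z 1)%C by (rewrite Cpow_1_r; reflexivity).
      apply (is_series_single (V := C_NormedModule) (fun n => c n * Cpow z n)%C).
      intros n Hn. rewrite Hvan by exact Hn. apply Cmult_0_l. }
  exists (c 1%nat). split; [|exact Hlin].
  (* If |c 1| > 1, the point 1 / |c 1| lies in the disc but is sent to a point of modulus 1. *)
  apply Rnot_lt_le. intros Hgt.
  set (z := RtoC (/ Cmod (c 1%nat))).
  assert (Hpos : 0 < / Cmod (c 1%nat)) by (apply Rinv_0_lt_compat; lra).
  assert (Hzm : Cmod z = / Cmod (c 1%nat)).
  { unfold z. rewrite Cmod_R. apply Rabs_right. lra. }
  assert (Hz : in_disc z).
  { unfold in_disc. rewrite Hzm. rewrite <- Rinv_1. apply Rinv_lt_contravar; lra. }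
  pose proof (proj2 Hphi z Hz) as Hlt. unfold in_disc in Hlt.
  rewrite (Hlin z Hz), Cmod_mult, Hzm, Rinv_r in Hlt; lra.
Qed.

(** * Uniqueness of power series coefficients, and the converse direction *)

Lemma is_series_Re_Im (u : nat -> C) (l : C) :
  @is_series C_AbsRing C_NormedModule u l ->
  @is_series R_AbsRing R_NormedModule (fun n => Re (u n)) (Re l) /\
  @is_series R_AbsRing R_NormedModule (fun n => Im (u n)) (Im l).
Proof.
  intros H. split.
  - apply (filterlim_ext (fun n => Re (@sum_n C_AbelianMonoid u n))).
    + induction x as [|n IH]; [rewrite !sum_O; reflexivity|].
      rewrite !sum_Sn, <- IH. reflexivity.
    + eapply filterlim_comp; [exact H|].
      apply (continuous_fst (U := R_UniformSpace) (V := R_UniformSpace)).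
  - apply (filterlim_ext (fun n => Im (@sum_n C_AbelianMonoid u n))).
    + induction x as [|n IH]; [rewrite !sum_O; reflexivity|].
      rewrite !sum_Sn, <- IH. reflexivity.
    + eapply filterlim_comp; [exact H|].
      apply (continuous_snd (U := R_UniformSpace) (V := R_UniformSpace)).
Qed.

(** Both series define the same function near 0, and its n-th derivative there is n! times the n-th
    coefficient. The radii are positive because the terms at 1/2 tend to 0. *)
Lemma real_power_series_unique (a b : nat -> R) :
  (forall x, Rabs x < 1 -> exists w,
     is_series (fun n => a n * x ^ n) w /\ is_series (fun n => b n * x ^ n) w) ->
  forall n, a n = b n.
Proof.
  intros H n.
  assert (Hrad : forall u : nat -> R, ex_series (fun n => u n * (1 / 2) ^ n) ->
    Rbar_lt 0 (CV_radius u)).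
  { intros u Hu. apply ex_series_lim_0 in Hu.
    destruct (Rbar_lt_le_dec 0 (CV_radius u)) as [|Hle]; [assumption|exfalso].
    apply (CV_disk_outside u (1 / 2)); [|exact Hu].
    eapply Rbar_le_lt_trans; [exact Hle|]. simpl. rewrite Rabs_right; lra. }
  destruct (H (1 / 2)) as [w0 [Ha Hb]]; [rewrite Rabs_right; lra|].
  assert (Ra : Rbar_lt 0 (CV_radius a)) by (apply Hrad; exists w0; exact Ha).
  assert (Rb : Rbar_lt 0 (CV_radius b)) by (apply Hrad; exists w0; exact Hb).
  assert (E : Derive_n (PSeries a) n 0 = Derive_n (PSeries b) n 0).
  { apply Derive_n_ext_loc. exists (mkposreal 1 Rlt_0_1). intros x Hx.
    change (Rabs (x - 0) < 1) in Hx. rewrite Rminus_0_r in Hx.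
    destruct (H x Hx) as [w [H1 H2]].
    transitivity w; [|symmetry]; apply is_pseries_unique, is_pseries_R; assumption. }
  rewrite !Derive_n_coef in E by assumption.
  apply Rmult_eq_reg_r in E; [exact E|]. apply not_0_INR, fact_neq_0.
Qed.

(** At real points the real and imaginary parts separate into two real power series. *)
Lemma power_series_unique (u v : nat -> C) :
  (forall z, in_disc z -> exists w, h2_eval_is u z w /\ h2_eval_is v z w) ->
  forall n, u n = v n.
Proof.
  intros H.
  assert (K : forall x, Rabs x < 1 -> exists w,
    (is_series (fun n => Re (u n) * x ^ n) (Re w) /\
     is_series (fun n => Re (v n) * x ^ n) (Re w)) /\
    (is_series (fun n => Im (u n) * x ^ n) (Im w) /\
     is_series (fun n => Im (v n) * x ^ n) (Im w))).
  { intros x Hx. destruct (H (RtoC x)) as [w [H1 H2]].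
    { unfold in_disc. rewrite Cmod_R. exact Hx. }
    exists w. apply is_series_Re_Im in H1. apply is_series_Re_Im in H2.
    assert (ER : forall (s : nat -> C) n, Re (s n * Cpow (RtoC x) n) = Re (s n) * x ^ n)
      by (intros; rewrite <- RtoC_pow; apply re_scal_r).
    assert (EI : forall (s : nat -> C) n, Im (s n * Cpow (RtoC x) n) = Im (s n) * x ^ n)
      by (intros; rewrite <- RtoC_pow; apply im_scal_r).
    repeat split.
    - eapply is_series_ext; [apply (ER u)|apply H1].
    - eapply is_series_ext; [apply (ER v)|apply H2].
    - eapply is_series_ext; [apply (EI u)|apply H1].
    - eapply is_series_ext; [apply (EI v)|apply H2]. }
  intros n. rewrite (surjective_pairing (u n)), (surjective_pairing (v n)). f_equal.
  - apply (real_power_series_unique (fun n => Re (u n)) (fun n => Re (v n))).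
    intros x Hx. destruct (K x Hx) as [w [Hw _]]. exists (Re w). exact Hw.
  - apply (real_power_series_unique (fun n => Im (u n)) (fun n => Im (v n))).
    intros x Hx. destruct (K x Hx) as [w [_ Hw]]. exists (Im w). exact Hw.
Qed.

Lemma comp_op_linear_coef (phi : C -> C) (delta : C) (a c : nat -> C) :
  (forall z, in_disc z -> phi z = (delta * z)%C) -> comp_op_is phi a c ->
  forall n, c n = (a n * Cpow delta n)%C.
Proof.
  intros Hphi [_ Hc]. apply power_series_unique. intros z Hz.
  destruct (Hc z Hz) as [w [H1 H2]]. exists w. split; [exact H2|].
  rewrite Hphi in H1 by exact Hz.
  eapply is_series_ext; [|exact H1]. intros n. cbv beta. rewrite Cpow_mult_l. apply Cmult_assoc.
Qed.

(** Comparison with |a_n|^2 + |b_n|^2, which dominates |a_n| |b_n|, while |delta|^n <= 1. *)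
Lemma ex_series_H2_product (a b : nat -> C) (delta : C) :
  in_H2 a -> in_H2 b -> Cmod delta <= 1 ->
  @ex_series C_AbsRing C_NormedModule (fun n => a n * Cpow delta n * Cconj (b n))%C.
Proof.
  intros Ha Hb Hd.
  apply (@ex_series_le C_AbsRing C_CompleteNormedModule _
    (fun n => Cmod (a n) ^ 2 + Cmod (b n) ^ 2)).
  - intros n. change (Cmod (a n * Cpow delta n * Cconj (b n)) <= Cmod (a n) ^ 2 + Cmod (b n) ^ 2).
    rewrite !Cmod_mult, Cmod_conj, Cmod_pow.
    assert (H1 : 0 <= Cmod delta ^ n <= 1).
    { split; [apply pow_le, Cmod_ge_0|]. rewrite <- (pow1 n). apply pow_incr.
      split; [apply Cmod_ge_0|exact Hd]. }
    pose proof (Cmod_ge_0 (a n)). pose proof (Cmod_ge_0 (b n)).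
    apply Rle_trans with (Cmod (a n) * 1 * Cmod (b n)).
    + apply Rmult_le_compat_r; [assumption|]. apply Rmult_le_compat_l; lra.
    + simpl. nra.
  - exact (ex_series_plus (V := R_NormedModule) _ _ Ha Hb).
Qed.

Lemma linear_adjoint (phi : C -> C) (delta : C) :
  Cmod delta <= 1 -> (forall z, in_disc z -> phi z = (delta * z)%C) ->
  holo_self_map (fun z => Cconj delta * z)%C /\
  adjoint_is_comp phi (fun z => Cconj delta * z)%C.
Proof.
  intros Hd Hphi. split; [split|].
  - intros z _. exists (Cconj delta). apply Cderiv_is_derive, Cderiv_scal_id.
  - unfold in_disc. intros z Hz. rewrite Cmod_mult, Cmod_conj.
    pose proof (Cmod_ge_0 z). pose proof (Cmod_ge_0 delta). nra.
  - intros a b c d Ha Hb Hc Hd'.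
    (* Both inner products are this one series: conjugating b_n conj(delta)^n moves delta^n over to
       a_n. *)
    destruct (ex_series_H2_product a b delta Ha Hb Hd) as [l Hl].
    exists l. split.
    + eapply is_series_ext; [|exact Hl]. intros n. cbv beta.
      rewrite (comp_op_linear_coef phi delta a c Hphi Hc n). reflexivity.
    + eapply is_series_ext; [|exact Hl]. intros n. cbv beta.
      rewrite (comp_op_linear_coef _ (Cconj delta) b d (fun z _ => eq_refl) Hd' n).
      rewrite Cmult_conj, Cpow_conj, Cconj_conj, (Cmult_comm (Cconj (b n))).
      symmetry. apply Cmult_assoc.
Qed.

Theorem theorem3p1 (phi : C -> C) (Hphi : holo_self_map phi) :
  (exists psi : C -> C, holo_self_map psi /\ adjoint_is_comp phi psi) <->
  (exists delta : C, Cmod delta <= 1 /\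
     forall z : C, in_disc z -> phi z = (delta * z)%C).
Proof.
  split.
  - intros (psi & Hpsi & Hadj). exact (adjoint_comp_linear phi psi Hphi Hpsi Hadj).
  - intros (delta & Hd & Hlin). exists (fun z => Cconj delta * z)%C.
    exact (linear_adjoint phi delta Hd Hlin).
Qed.
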